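(* Let $b_+,b_->0$, $\delta_\pm\in\mathbb R$ with $b_\pm+\delta_\pm>0$ and $\delta_+\delta_-<0$, and $c>0$. Then there is a nonzero real constant $E^{(1)}_{\mathrm{II}}$, determined by $(b_\pm,\delta_\pm,c)$, such that for all sufficiently small but nonzero $|k|$ the type-II interface Hamiltonian $\hat H_{\mathrm{II}}(k)$ (defined in the context) has two distinct eigenvalues $E_{\mathrm{II},+}(k)$, $E_{\mathrm{II},-}(k)$ satisfying $$E_{\mathrm{II},\pm}(k)=\pm E^{(1)}_{\mathrm{II}}|k|+\mathcal O(k^2).$$
   Context: Coefficients: for $n\in\mathbb Z$ let $b_n=b_+$ for $n\ge0$ and $b_n=b_-$ for $n\le-1$; $c_n=b_++\delta_+$ for $n\ge0$, $c_{-1}=c$, $c_n=b_-+\delta_-$ for $n\le-2$; $d_n=b_++\delta_+$ for $n\ge0$, $d_{-1}=d_{-2}=c$, $d_n=b_-+\delta_-$ for $n\le-3$. For $k\in[-\pi,\pi)$, $\hat H_{\mathrm{II}}(k)$ is the bounded self-adjoint operator on $\ell^2(\mathbb Z;\mathbb C^6)$ acting on $w=\{(w_{j,n})_{j=1}^6\}_{n\in\mathbb Z}$ by $(\hat H_{\mathrm{II}}(k)w)_{1,n}=-b_nw_{4,n}-b_nw_{5,n}-c_ne^{-ik}w_{6,n+1}$, $(\hat H_{\mathrm{II}}(k)w)_{2,n}=-b_nw_{4,n}-d_{n-2}e^{ik}w_{5,n-2}-b_nw_{6,n}$, $(\hat H_{\mathrm{II}}(k)w)_{3,n}=-c_nw_{4,n+1}-b_nw_{5,n}-b_nw_{6,n}$,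 $(\hat H_{\mathrm{II}}(k)w)_{4,n}=-b_nw_{1,n}-b_nw_{2,n}-c_{n-1}w_{3,n-1}$, $(\hat H_{\mathrm{II}}(k)w)_{5,n}=-b_nw_{1,n}-d_ne^{-ik}w_{2,n+2}-b_nw_{3,n}$, $(\hat H_{\mathrm{II}}(k)w)_{6,n}=-c_{n-1}e^{ik}w_{1,n-1}-b_nw_{2,n}-b_nw_{3,n}$. *)

(* Defs.v *)
From Stdlib Require Import Reals ZArith.
From Coquelicot Require Import Coquelicot.
Open Scope R_scope.

Definition coef_b (bp bm : R) (n : Z) : R :=
  if Z.leb 0 n then bp else bm.

Definition coef_c (bp bm dp dm c : R) (n : Z) : R :=
  if Z.leb 0 n then bp + dp
  else if Z.eqb n (-1) then c
  else bm + dm.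

Definition coef_d (bp bm dp dm c : R) (n : Z) : R :=
  if Z.leb 0 n then bp + dp
  else if Z.leb (-2) n then c
  else bm + dm.

Definition cexpi (k : R) : C := (cos k, sin k).

(* A vector w in C^6-valued sequences: w j n = w_{j,n}, components j = 1..6. *)
Definition vec := nat -> Z -> C.

Definition H_II (bp bm dp dm c k : R) (w : vec) : vec :=
  fun j n =>
  let b := fun m => RtoC (coef_b bp bm m) in
  let cc := fun m => RtoC (coef_c bp bm dp dm c m) in
  let d := fun m => RtoC (coef_d bp bm dp dm c m) in
  match j with
  | 1%nat => Copp (Cplus (Cplus (Cmult (b n) (w 4%nat n)) (Cmult (b n) (w 5%nat n)))
                        (Cmult (Cmult (cc n) (cexpi (- k))) (w 6%nat (n + 1)%Z)))
  | 2%nat => Copp (Cplus (Cplus (Cmult (b n) (w 4%nat n))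
                               (Cmult (Cmult (d (n - 2)%Z) (cexpi k)) (w 5%nat (n - 2)%Z)))
                        (Cmult (b n) (w 6%nat n)))
  | 3%nat => Copp (Cplus (Cplus (Cmult (cc n) (w 4%nat (n + 1)%Z)) (Cmult (b n) (w 5%nat n)))
                        (Cmult (b n) (w 6%nat n)))
  | 4%nat => Copp (Cplus (Cplus (Cmult (b n) (w 1%nat n)) (Cmult (b n) (w 2%nat n)))
                        (Cmult (cc (n - 1)%Z) (w 3%nat (n - 1)%Z)))
  | 5%nat => Copp (Cplus (Cplus (Cmult (b n) (w 1%nat n))
                               (Cmult (Cmult (d n) (cexpi (- k))) (w 2%nat (n + 2)%Z)))
                        (Cmult (b n) (w 3%nat n)))
  | 6%nat => Copp (Cplus (Cplus (Cmult (Cmult (cc (n - 1)%Z) (cexpi k)) (w 1%nat (n - 1)%Z))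
                               (Cmult (b n) (w 2%nat n)))
                        (Cmult (b n) (w 3%nat n)))
  | _ => RtoC 0
  end.

Definition valid_index (j : nat) : Prop := (1 <= j <= 6)%nat.

Definition in_l2 (w : vec) : Prop :=
  forall j, valid_index j ->
    ex_series (fun m : nat => (Cmod (w j (Z.of_nat m))) ^ 2) /\
    ex_series (fun m : nat => (Cmod (w j (- Z.of_nat m - 1)%Z)) ^ 2).

Definition nonzero_vec (w : vec) : Prop :=
  exists j n, valid_index j /\ w j n <> RtoC 0.

Definition is_eigenvalue_II (bp bm dp dm c k E : R) : Prop :=
  exists w : vec, in_l2 w /\ nonzero_vec w /\
    forall j n, valid_index j ->
      H_II bp bm dp dm c k w j n = Cmult (RtoC E) (w j n).

(* Main.v *)
(** After the gauge change [w_{j,n} -> exp(i k n / 2) w_{j,n}], the combinations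
    [w_4 = S + i A], [w_6 = S - i A], [w_5 = Y], [w_1 = P + i Q], [w_3 = P - i Q], [w_2 = R]
    turn the eigenvalue problem into a real one, in which [sin (k / 2)] couples a part [(S, Y, P, R)]
    to a part [(A, Q)].  The reflection [n -> -1 - n] exchanges the two half-planes, so one may
    take [dp > 0 > dm].  At [k = E = 0] there are then two positive zero modes, one in [A] and
    one in [(P, R)].  For small parameters all equations except those for [Q] and [S] at
    [n = 0] are solved, for prescribed [A_0] and [P_0], by a Neumann series in a
    sup norm with exponential weights.  Summation by parts against the zero modes shows that the two
    remaining residuals are given by a 2x2 matrix
    [((E N1, s k1), (s k2, E N2)) + O(E^2 + s^2)], with [s = sin (k / 2)] and positive constants;
    the intermediate value theorem, applied to its determinant, gives the eigenvalue
    [E = sqrt (k1 k2 / (N1 N2)) |s| + O(s^2)], and changing the sign of [w_1, w_2, w_3] gives [-E]. *)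

Require Import Defs.
From Stdlib Require Import Reals ZArith Lra Lia Ranalysis5.
From Coquelicot Require Import Coquelicot.
Open Scope R_scope.

(** * Neumann series in weighted sup norms *)

(** At zero parameters everything follows from counting decaying directions. The recursion for [cA]
    contracts away from the interface on both sides, the one for [cQ] towards it: the former leaves
    a free value, the latter a solvability condition. For [cP] all solutions decay to the left, but
    only one of the two characteristic roots decays to the right, which leaves one free value; [cS]
    obeys the adjoint recursion and carries the dual condition. Two free values against two
    conditions give the 2x2 matrix. The obstacle is the second-order recursion on the right: with
    one root inside and one outside the unit circle it cannot be iterated in a single direction.
    Factoring it gives two first-order recursions, each contracting in its own direction. To first
    order [E] pairs each mode with itself and [s] pairs the two modes with each other, so the slope
    is nonzero as soon as the four overlaps are. Their positivity comes from the signs of the modes,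
    without any explicit formula. *)

Section WeightedNeumann.

Context {A B : Type}.
Variable W : A -> B -> R.
Hypothesis W_pos : forall j n, 0 < W j n.

Definition wbounded (M : R) (x : A -> B -> R) : Prop :=
  forall j n, Rabs (x j n) <= M * W j n.

(** The part of linearity that compares two iterates, stated entry by entry so that states never
    have to be equal as functions. *)
Definition subtractive (T : (A -> B -> R) -> A -> B -> R) : Prop :=
  forall x y j n, T (fun i m => x i m - y i m) j n = T x j n - T y j n.

Definition contractive (lam : R) (T : (A -> B -> R) -> A -> B -> R) : Prop :=
  forall M x, 0 <= M -> wbounded M x -> wbounded (lam * M) (T x).

Fixpoint neumann_iter (T : (A -> B -> R) -> A -> B -> R) (f : A -> B -> R)
    (m : nat) : A -> B -> R :=
  match m with
  | O => fun _ _ => 0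
  | S m' => fun j n => f j n + T (neumann_iter T f m') j n
  end.

(** The limit of the iterates, written as a telescoping series so that convergence is a comparison
    with a geometric series. *)
Definition neumann T f : A -> B -> R := fun j n =>
  Series (fun m => neumann_iter T f (S m) j n - neumann_iter T f m j n).

(** An a priori bound [M0], however large, improves at each use of the recursion: after [m] uses it
    has become [lam ^ m * M0 + eta / (1 - lam)]. *)
Lemma geometric_recursion_bound (lam eta : R) (D : A -> B -> R) T g M0 :
  0 <= lam < 1 -> 0 <= eta -> 0 <= M0 -> contractive lam T ->
  wbounded M0 D -> wbounded eta g ->
  (forall j n, D j n = g j n + T D j n) ->
  wbounded (eta / (1 - lam)) D.
Proof.
  intros Hl He HM HT HD Hg Heq.
  assert (Hm : forall m, wbounded (lam ^ m * M0 + eta / (1 - lam)) D).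
  { induction m as [|m IH].
    - intros j n. simpl. apply Rle_trans with (1 := HD j n).
      apply Rmult_le_compat_r; [apply Rlt_le, W_pos|].
      assert (0 <= eta / (1 - lam)) by (apply Rdiv_le_0_compat; lra). lra.
    - intros j n. rewrite Heq.
      apply Rle_trans with (1 := Rabs_triang _ _).
      assert (Hq : 0 <= eta / (1 - lam)) by (apply Rdiv_le_0_compat; lra).
      assert (Hp : 0 <= lam ^ m * M0).
      { apply Rmult_le_pos; [apply pow_le; lra|lra]. }
      assert (HTD := HT _ D (Rplus_le_le_0_compat _ _ Hp Hq) IH j n).
      specialize (Hg j n). simpl.
      replace ((lam * lam ^ m * M0 + eta / (1 - lam)) * W j n) with
        (eta * W j n + lam * (lam ^ m * M0 + eta / (1 - lam)) * W j n)
        by (field; lra).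
      lra. }
  intros j n.
  apply Rnot_lt_le; intros Hlt.
  (* If the limit bound failed at this entry by [gap], a high enough power of [lam] would bring the
     transient term below [gap]. *)
  set (gap := Rabs (D j n) - eta / (1 - lam) * W j n) in *.
  assert (Hgap : 0 < gap) by (unfold gap; lra).
  destruct (pow_lt_1_zero lam) with (y := gap / (M0 * W j n + 1)) as [N HN].
  - rewrite Rabs_pos_eq; lra.
  - apply Rdiv_lt_0_compat; [lra|].
    assert (0 <= M0 * W j n) by (apply Rmult_le_pos; [lra|apply Rlt_le, W_pos]). lra.
  - specialize (HN N (le_n _)). specialize (Hm N j n).
    rewrite Rabs_pos_eq in HN by (apply pow_le; lra).
    assert (H0 : 0 <= M0 * W j n) by (apply Rmult_le_pos; [lra|apply Rlt_le, W_pos]).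
    apply Rlt_div_r in HN; [|lra].
    assert (0 <= lam ^ N) by (apply pow_le; lra).
    unfold gap in *. nra.
Qed.

Section FixedPoint.

Variables (T : (A -> B -> R) -> A -> B -> R) (f : A -> B -> R) (lam M : R).
Hypotheses (Hlam : 0 <= lam < 1) (HM : 0 <= M)
  (HT : contractive lam T) (Tsub : subtractive T) (Hf : wbounded M f).

Lemma neumann_iter_step m : wbounded (lam ^ m * M)
  (fun j n => neumann_iter T f (S m) j n - neumann_iter T f m j n).
Proof.
  induction m as [|m IH]; intros j n.
  (* Contractivity with [M = 0] forces [T] to vanish at zero, so the first increment is [f]
     itself. *)
  - simpl. assert (T (fun _ _ => 0) j n = 0).
    { assert (H := HT 0 (fun _ _ => 0) (Rle_refl 0)).
      assert (H0 : Rabs (T (fun _ _ => 0) j n) <= lam * 0 * W j n).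
      { apply H. intros i m. rewrite Rabs_R0. lra. }
      rewrite Rmult_0_r, Rmult_0_l in H0. apply Rabs_eq_0.
      apply Rle_antisym; [exact H0|apply Rabs_pos]. }
    rewrite H. replace (f j n + 0 - 0) with (f j n) by ring.
    rewrite Rmult_1_l. apply Hf.
  - assert (H : 0 <= lam ^ m * M) by (apply Rmult_le_pos; [apply pow_le; lra|lra]).
    assert (H1 := HT _ _ H IH j n). rewrite Tsub in H1.
    replace (lam ^ S m * M) with (lam * (lam ^ m * M)) by (simpl; ring).
    replace (neumann_iter T f (S (S m)) j n - neumann_iter T f (S m) j n) with
      (T (neumann_iter T f (S m)) j n - T (neumann_iter T f m) j n).
    + exact H1.
    + change (neumann_iter T f (S (S m)) j n) with
        (f j n + T (neumann_iter T f (S m)) j n).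
      change (neumann_iter T f (S m) j n) with (f j n + T (neumann_iter T f m) j n).
      ring.
Qed.

Lemma is_series_geom_scaled (a : R) : is_series (fun m => lam ^ m * a) (a / (1 - lam)).
Proof.
  apply is_series_ext with (fun m => a * lam ^ m).
  { intros m. apply Rmult_comm. }
  apply (is_series_scal (K := R_AbsRing) (V := R_NormedModule) a (fun m => lam ^ m)).
  apply is_series_geom. rewrite Rabs_pos_eq; lra.
Qed.

Lemma ex_series_neumann j n : ex_series
  (fun m => Rabs (neumann_iter T f (S m) j n - neumann_iter T f m j n)).
Proof.
  apply (ex_series_le (V := R_CompleteNormedModule)) with (fun m => lam ^ m * (M * W j n)).
  - intros m. unfold norm; simpl. unfold abs; simpl. rewrite Rabs_Rabsolu.
    rewrite <- Rmult_assoc. apply (neumann_iter_step m).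
  - eexists. apply is_series_geom_scaled.
Qed.

Lemma neumann_iter_sum j n m :
  sum_n (fun i => neumann_iter T f (S i) j n - neumann_iter T f i j n) m
  = neumann_iter T f (S m) j n.
Proof.
  induction m as [|m IH].
  - rewrite sum_O. simpl. ring.
  - rewrite sum_Sn, IH. unfold plus; simpl. ring.
Qed.

Lemma is_lim_seq_neumann j n :
  is_lim_seq (fun m => neumann_iter T f (S m) j n) (neumann T f j n).
Proof.
  assert (H := Series_correct _ (ex_series_Rabs _ (ex_series_neumann j n))).
  apply is_lim_seq_ext with (2 := H). intros m. apply neumann_iter_sum.
Qed.

Lemma neumann_tail m : wbounded (lam ^ S m * (M / (1 - lam)))
  (fun j n => neumann T f j n - neumann_iter T f (S m) j n).
Proof.
  intros j n.
  assert (He := ex_series_neumann j n).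
  unfold neumann.
  rewrite (Series_incr_n _ (S m)); [|lia|apply ex_series_Rabs, He].
  simpl pred. rewrite <- sum_n_Reals, neumann_iter_sum.
  match goal with |- Rabs (?a + ?b - ?a) <= _ => replace (a + b - a) with b by ring end.
  apply ex_series_incr_n with (n := S m) in He.
  apply Rle_trans with (1 := Series_Rabs _ He).
  replace (lam ^ S m * (M / (1 - lam)) * W j n) with
    (Series (fun i => lam ^ i * (lam ^ S m * M * W j n))).
  - apply Series_le.
    + intros i. split; [apply Rabs_pos|].
      apply Rle_trans with (1 := neumann_iter_step (S m + i) j n).
      rewrite pow_add. right. ring.
    + eexists. apply is_series_geom_scaled.
  - rewrite (is_series_unique _ _ (is_series_geom_scaled _)). field. lra.
Qed.

Lemma neumann_bounded : wbounded (M / (1 - lam)) (neumann T f).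
Proof.
  assert (H0 : 0 <= M / (1 - lam)) by (apply Rdiv_le_0_compat; lra).
  intros j n. assert (H := neumann_tail 0 j n). assert (H1 := neumann_iter_step 0 j n).
  cbv beta in H, H1. change (neumann_iter T f 0 j n) with 0 in H1.
  rewrite Rminus_0_r in H1. simpl pow in *.
  assert (Ht := Rabs_triang (neumann T f j n - neumann_iter T f 1 j n) (neumann_iter T f 1 j n)).
  replace (neumann T f j n - neumann_iter T f 1 j n + neumann_iter T f 1 j n)
    with (neumann T f j n) in Ht by ring.
  replace (M / (1 - lam) * W j n) with
    (lam * 1 * (M / (1 - lam)) * W j n + 1 * M * W j n) by (field; lra).
  lra.
Qed.

(** Both sides are limits of the shifted iterates: [neumann_tail] bounds the distance to the limit
    in the weighted norm, and [T] contracts that distance. *)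
Lemma neumann_fixed j n : neumann T f j n = f j n + T (neumann T f) j n.
Proof.
  assert (H1 : is_lim_seq (fun m => neumann_iter T f (S (S m)) j n) (neumann T f j n)).
  { apply is_lim_seq_incr_1 with (u := fun m => neumann_iter T f (S m) j n).
    apply is_lim_seq_neumann. }
  assert (H2 : is_lim_seq (fun m => neumann_iter T f (S (S m)) j n)
                 (f j n + T (neumann T f) j n)).
  { assert (Hq : 0 <= M / (1 - lam)) by (apply Rdiv_le_0_compat; lra).
    apply is_lim_seq_spec. intros eps.
    set (c0 := M / (1 - lam) * W j n).
    assert (Hc : 0 <= c0) by (apply Rmult_le_pos; [lra|apply Rlt_le, W_pos]).
    destruct (pow_lt_1_zero lam) with (y := eps / (c0 + 1)) as [N HN].
    { rewrite Rabs_pos_eq; lra. }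
    { apply Rdiv_lt_0_compat; [apply cond_pos|lra]. }
    exists N. intros m Hm.
    assert (Ht := neumann_tail m).
    assert (Hp : 0 <= lam ^ S m * (M / (1 - lam))).
    { apply Rmult_le_pos; [apply pow_le; lra|lra]. }
    assert (HTd := HT _ _ Hp Ht j n). rewrite Tsub in HTd.
    change (neumann_iter T f (S (S m)) j n) with (f j n + T (neumann_iter T f (S m)) j n).
    replace (f j n + T (neumann_iter T f (S m)) j n - (f j n + T (neumann T f) j n))
      with (- (T (neumann T f) j n - T (neumann_iter T f (S m)) j n)) by ring.
    rewrite Rabs_Ropp. apply Rle_lt_trans with (1 := HTd).
    replace (lam * (lam ^ S m * (M / (1 - lam))) * W j n) with (lam ^ S (S m) * c0)
      by (unfold c0; simpl; ring).
    assert (HNm := HN (S (S m)) ltac:(lia)).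
    rewrite Rabs_pos_eq in HNm by (apply pow_le; lra).
    apply Rlt_div_r in HNm; [|lra].
    assert (0 <= lam ^ S (S m)) by (apply pow_le; lra). nra. }
  apply is_lim_seq_unique in H1. apply is_lim_seq_unique in H2.
  rewrite H1 in H2. now injection H2.
Qed.

(** Sign conditions preserved by one step hold for the zero start and survive the limit. An entry
    lying in both [J1] and [J2] is thereby shown to vanish. *)
Lemma neumann_sign (J1 J2 : A -> B -> Prop) :
  (forall x, (forall j n, (J1 j n -> 0 <= x j n) /\ (J2 j n -> x j n <= 0)) ->
     forall j n, (J1 j n -> 0 <= f j n + T x j n) /\ (J2 j n -> f j n + T x j n <= 0)) ->
  forall j n, (J1 j n -> 0 <= neumann T f j n) /\ (J2 j n -> neumann T f j n <= 0).
Proof.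
  intros Hstep.
  assert (Hit : forall m j n, (J1 j n -> 0 <= neumann_iter T f m j n)
                           /\ (J2 j n -> neumann_iter T f m j n <= 0)).
  { induction m as [|m IH]; [intros; simpl; split; lra|].
    apply Hstep, IH. }
  intros j n. split; intros HJ.
  - apply (is_lim_seq_le (fun _ => 0) (fun m => neumann_iter T f (S m) j n) 0
             (neumann T f j n)).
    + intros m. now apply Hit.
    + apply is_lim_seq_const.
    + apply is_lim_seq_neumann.
  - apply (is_lim_seq_le (fun m => neumann_iter T f (S m) j n) (fun _ => 0)
             (neumann T f j n) 0).
    + intros m. now apply Hit.
    + apply is_lim_seq_neumann.
    + apply is_lim_seq_const.
Qed.

End FixedPoint.

(** The difference [D] of the two fixed points satisfies [D = (T - T') x' + T D] with [x'] the
    second one, a recursion whose source is controlled by [eta]. *)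
Lemma neumann_lipschitz T T' f lam M eta :
  0 <= lam < 1 -> 0 <= M -> 0 <= eta ->
  contractive lam T -> contractive lam T' -> subtractive T -> subtractive T' ->
  wbounded M f ->
  (forall x M', 0 <= M' -> wbounded M' x ->
     wbounded (eta * M') (fun j n => T x j n - T' x j n)) ->
  wbounded (eta * (M / (1 - lam)) / (1 - lam))
    (fun j n => neumann T f j n - neumann T' f j n).
Proof.
  intros Hl HM He HT HT' Ts Ts' Hf Hd.
  assert (Hq : 0 <= M / (1 - lam)) by (apply Rdiv_le_0_compat; lra).
  assert (HB := neumann_bounded T f lam M Hl HM HT Ts Hf).
  assert (HB' := neumann_bounded T' f lam M Hl HM HT' Ts' Hf).
  apply geometric_recursion_bound with (T := T) (M0 := M / (1 - lam) + M / (1 - lam))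
    (g := fun j n => T (neumann T' f) j n - T' (neumann T' f) j n); trivial.
  - now apply Rmult_le_pos.
  - lra.
  - intros j n. specialize (HB j n). specialize (HB' j n).
    assert (H := Rabs_triang (neumann T f j n) (- neumann T' f j n)).
    rewrite Rabs_Ropp in H.
    change (neumann T f j n - neumann T' f j n) with (neumann T f j n + - neumann T' f j n).
    lra.
  - now apply Hd.
  - intros j n. rewrite Ts.
    rewrite (neumann_fixed T f lam M Hl HM HT Ts Hf j n) at 1.
    rewrite (neumann_fixed T' f lam M Hl HM HT' Ts' Hf j n) at 1.
    ring.
Qed.

End WeightedNeumann.

(** * Two-sided sums of decaying sequences *)

Definition zpow (rho : R) (n : Z) : R := rho ^ Z.abs_nat n.

Definition decays (rho M : R) (x : Z -> R) : Prop :=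
  forall n, Rabs (x n) <= M * zpow rho n.

Definition Zsum (x : Z -> R) : R :=
  Series (fun m => x (Z.of_nat m)) + Series (fun m => x (- Z.of_nat m - 1)%Z).

Section TwoSidedSums.

Variable rho : R.
Hypothesis Hrho : 0 < rho < 1.

Lemma zpow_pos n : 0 < zpow rho n.
Proof. apply pow_lt; lra. Qed.

Lemma zpow_le_1 n : zpow rho n <= 1.
Proof. unfold zpow. rewrite <- (pow1 (Z.abs_nat n)). apply pow_incr. lra. Qed.

Lemma zpow_succ n : (0 <= n)%Z -> zpow rho (n + 1) = rho * zpow rho n.
Proof.
  intros Hn. unfold zpow. replace (Z.abs_nat (n + 1)) with (S (Z.abs_nat n)) by lia.
  reflexivity.
Qed.

Lemma zpow_pred n : (n <= 0)%Z -> zpow rho (n - 1) = rho * zpow rho n.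
Proof.
  intros Hn. unfold zpow. replace (Z.abs_nat (n - 1)) with (S (Z.abs_nat n)) by lia.
  reflexivity.
Qed.

Lemma pow_decr a b : (a <= b)%nat -> rho ^ b <= rho ^ a.
Proof.
  intros Hab. replace b with (a + (b - a))%nat by lia. rewrite pow_add.
  assert (0 < rho ^ a) by (apply pow_lt; lra).
  assert (rho ^ (b - a) <= 1).
  { rewrite <- (pow1 (b - a)). apply pow_incr. lra. }
  nra.
Qed.

(** The Hamiltonian couples sites at distance at most two; this is the price of moving a weight that
    far. *)
Lemma zpow_near n m : (Z.abs (n - m) <= 2)%Z -> zpow rho m <= / rho ^ 2 * zpow rho n.
Proof.
  intros H. apply Rmult_le_reg_l with (rho ^ 2); [apply pow_lt; lra|].
  rewrite <- Rmult_assoc, Rinv_r, Rmult_1_l by (apply pow_nonzero; lra).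
  unfold zpow. rewrite <- pow_add. apply pow_decr. lia.
Qed.

Lemma decays_near M x i : (Z.abs i <= 2)%Z -> 0 <= M -> decays rho M x ->
  decays rho (/ rho ^ 2 * M) (fun n => x (n + i)%Z).
Proof.
  intros Hi HM Hx n. apply Rle_trans with (1 := Hx _).
  rewrite (Rmult_comm _ M), Rmult_assoc. apply Rmult_le_compat_l; trivial.
  apply zpow_near. lia.
Qed.

Lemma decays_mult M M' x y : 0 <= M -> 0 <= M' -> decays rho M x -> decays rho M' y ->
  decays rho (M * M') (fun n => x n * y n).
Proof.
  intros HM HM' Hx Hy n. rewrite Rabs_mult.
  assert (H1 := zpow_pos n). assert (H2 := zpow_le_1 n).
  apply Rle_trans with ((M * zpow rho n) * (M' * zpow rho n)).
  - apply Rmult_le_compat; [apply Rabs_pos|apply Rabs_pos|apply Hx|apply Hy].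
  - assert (0 <= M * M') by now apply Rmult_le_pos.
    replace (M * zpow rho n * (M' * zpow rho n)) with
      ((M * M') * (zpow rho n * zpow rho n)) by ring.
    apply Rmult_le_compat_l; trivial. nra.
Qed.

Lemma decays_ex_series M x : decays rho M x ->
  ex_series (fun m => Rabs (x (Z.of_nat m))) /\
  ex_series (fun m => Rabs (x (- Z.of_nat m - 1)%Z)).
Proof.
  intros Hx.
  assert (HM : 0 <= M).
  { specialize (Hx 0%Z). assert (H := Rabs_pos (x 0%Z)).
    unfold zpow in Hx. simpl in Hx. lra. }
  assert (Hg : ex_series (fun m => M * rho ^ m)).
  { apply (ex_series_scal (K := R_AbsRing) (V := R_NormedModule) M (fun m => rho ^ m)).
    apply ex_series_geom. rewrite Rabs_pos_eq; lra. }
  split; apply (ex_series_le (V := R_CompleteNormedModule)) with (2 := Hg);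
    intros m; change (norm ?z) with (Rabs z); rewrite Rabs_Rabsolu;
    apply Rle_trans with (1 := Hx _); apply Rmult_le_compat_l; trivial;
    apply pow_decr; lia.
Qed.

Lemma decays_Zsum M x : decays rho M x -> Rabs (Zsum x) <= 2 * M / (1 - rho).
Proof.
  intros Hx. destruct (decays_ex_series _ _ Hx) as [H1 H2].
  assert (HM : 0 <= M).
  { specialize (Hx 0%Z). assert (H := Rabs_pos (x 0%Z)).
    unfold zpow in Hx. simpl in Hx. lra. }
  assert (Hg : is_series (fun m => M * rho ^ m) (M * / (1 - rho))).
  { apply (is_series_scal (K := R_AbsRing) (V := R_NormedModule) M (fun m => rho ^ m)).
    apply is_series_geom. rewrite Rabs_pos_eq; lra. }
  assert (He : ex_series (fun m => M * rho ^ m)) by (eexists; apply Hg).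
  unfold Zsum. apply Rle_trans with (1 := Rabs_triang _ _).
  replace (2 * M / (1 - rho)) with (M * / (1 - rho) + M * / (1 - rho)) by (field; lra).
  rewrite <- (is_series_unique _ _ Hg).
  apply Rplus_le_compat.
  - apply Rle_trans with (1 := Series_Rabs _ H1).
    apply Series_le; trivial. intros m. split; [apply Rabs_pos|].
    apply Rle_trans with (1 := Hx _); apply Rmult_le_compat_l; trivial;
    apply pow_decr; lia.
  - apply Rle_trans with (1 := Series_Rabs _ H2).
    apply Series_le; trivial. intros m. split; [apply Rabs_pos|].
    apply Rle_trans with (1 := Hx _); apply Rmult_le_compat_l; trivial;
    apply pow_decr; lia.
Qed.

Lemma Zsum_minus M M' x y : decays rho M x -> decays rho M' y ->
  Zsum (fun n => x n - y n) = Zsum x - Zsum y.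
Proof.
  intros Hx Hy. destruct (decays_ex_series _ _ Hx) as [H1 H2].
  destruct (decays_ex_series _ _ Hy) as [H3 H4]. unfold Zsum.
  rewrite 2!Series_minus; try (now apply ex_series_Rabs). ring.
Qed.

Lemma Zsum_scal a x : Zsum (fun n => a * x n) = a * Zsum x.
Proof. unfold Zsum. rewrite 2!Series_scal_l. ring. Qed.

Lemma Zsum_pos M x m : decays rho M x -> (forall n, 0 <= x n) -> 0 < x (Z.of_nat m) ->
  0 < Zsum x.
Proof.
  intros Hx Hp Hm. destruct (decays_ex_series _ _ Hx) as [H1 H2].
  apply ex_series_Rabs in H1. apply ex_series_Rabs in H2.
  assert (Hnn : forall u : nat -> R, ex_series u -> (forall i, 0 <= u i) -> 0 <= Series u).
  { intros u Hu Hi.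
    rewrite <- (Rmult_0_l (Series u)), <- Series_scal_l.
    apply Series_le; trivial. intros i. specialize (Hi i). lra. }
  unfold Zsum.
  rewrite (Series_incr_n _ (S m)); [|lia|trivial].
  simpl pred.
  assert (HA : 0 <= Series (fun k => x (Z.of_nat (S m + k)))).
  { apply Hnn; [|intros; apply Hp].
    apply (ex_series_incr_n (fun k => x (Z.of_nat k)) (S m)), H1. }
  assert (HB : 0 <= Series (fun k => x (- Z.of_nat k - 1)%Z)).
  { apply Hnn; [trivial|intros; apply Hp]. }
  assert (HC : x (Z.of_nat m) <= sum_f_R0 (fun k => x (Z.of_nat k)) m).
  { destruct m as [|m]; [simpl; lra|]. rewrite tech5.
    assert (0 <= sum_f_R0 (fun k => x (Z.of_nat k)) m).
    { apply cond_pos_sum. intros; apply Hp. }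
    lra. }
  lra.
Qed.

Lemma decays_lim M x (u : nat -> Z) : decays rho M x ->
  (forall m, (m <= Z.abs_nat (u m))%nat) -> is_lim_seq (fun m => x (u m)) 0.
Proof.
  intros Hx Hu.
  assert (HM : 0 <= M).
  { specialize (Hx 0%Z). assert (H := Rabs_pos (x 0%Z)).
    unfold zpow in Hx. simpl in Hx. lra. }
  apply is_lim_seq_abs_0.
  apply is_lim_seq_le_le with (fun _ => 0) (fun m => M * rho ^ m).
  - intros m. split; [apply Rabs_pos|]. apply Rle_trans with (1 := Hx _).
    apply Rmult_le_compat_l; trivial. apply pow_decr, Hu.
  - apply is_lim_seq_const.
  - replace (Finite 0) with (Rbar_mult M 0) by (simpl; f_equal; ring).
    apply is_lim_seq_scal_l. apply is_lim_seq_geom. rewrite Rabs_pos_eq; lra.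
Qed.

(** Each half-line telescopes down to its end at the interface because [Th] tends to zero; what
    remains is the site 0, where the difference formula is not assumed. *)
Lemma Zsum_telescope M Th y : decays rho M Th ->
  (forall n, n <> 0%Z -> y n = Th n - Th (n - 1)%Z) ->
  Zsum y = y 0%Z - (Th 0%Z - Th (-1)%Z).
Proof.
  intros HTh Hy. unfold Zsum.
  assert (HR : is_series (fun m => y (Z.of_nat m)) (y 0%Z - Th 0%Z)).
  { change (is_lim_seq (sum_n (fun m => y (Z.of_nat m))) (y 0%Z - Th 0%Z)).
    apply is_lim_seq_ext with (fun m => (y 0%Z - Th 0%Z) + Th (Z.of_nat m)).
    - induction n as [|n IH].
      + rewrite sum_O. simpl. ring.
      + rewrite sum_Sn, <- IH. change (plus ?a ?b) with (a + b).
        rewrite (Hy (Z.of_nat (S n))) by lia.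
        replace (Z.of_nat (S n) - 1)%Z with (Z.of_nat n) by lia. ring.
    - replace (Finite (y 0%Z - Th 0%Z)) with (Finite ((y 0%Z - Th 0%Z) + 0)) by (f_equal; ring).
      apply is_lim_seq_plus'; [apply is_lim_seq_const|].
      apply decays_lim with (M := M) (u := Z.of_nat); trivial. intros; lia. }
  assert (HL : is_series (fun m => y (- Z.of_nat m - 1)%Z) (Th (-1)%Z)).
  { change (is_lim_seq (sum_n (fun m => y (- Z.of_nat m - 1)%Z)) (Th (-1)%Z)).
    apply is_lim_seq_ext with (fun m => Th (-1)%Z - Th (- Z.of_nat m - 2)%Z).
    - induction n as [|n IH].
      + rewrite sum_O. simpl. rewrite Hy by lia. reflexivity.
      + rewrite sum_Sn, <- IH. change (plus ?a ?b) with (a + b).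
        rewrite (Hy (- Z.of_nat (S n) - 1)%Z) by lia.
        replace (- Z.of_nat (S n) - 1 - 1)%Z with (- Z.of_nat (S n) - 2)%Z by lia.
        replace (- Z.of_nat (S n) - 1)%Z with (- Z.of_nat n - 2)%Z by lia. ring.
    - replace (Finite (Th (-1)%Z)) with (Finite (Th (-1)%Z - 0)) by (f_equal; ring).
      apply is_lim_seq_minus'; [apply is_lim_seq_const|].
      apply decays_lim with (M := M) (u := fun m => (- Z.of_nat m - 2)%Z); trivial.
      intros; lia. }
  rewrite (is_series_unique _ _ HR), (is_series_unique _ _ HL). ring.
Qed.

End TwoSidedSums.

(** * Zeros of a perturbed 2x2 determinant *)

(** First-order factors with second-order errors have a product with third-order error; [X <= 1]
    absorbs the fourth-order term. *)
Lemma product_error x y u v X A A' C : Rabs x <= A * X -> Rabs y <= A' * X ->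
  0 <= A -> 0 <= A' -> 0 <= C -> 0 <= X <= 1 ->
  Rabs (u - x) <= C * X ^ 2 -> Rabs (v - y) <= C * X ^ 2 ->
  Rabs (u * v - x * y) <= C * (A + A' + C) * X ^ 3.
Proof.
  intros Hx Hy HA HA' HC HX Hu Hv.
  replace (u * v - x * y) with (x * (v - y) + (u - x) * y + (u - x) * (v - y)) by ring.
  apply Rle_trans with (A * X * (C * X ^ 2) + C * X ^ 2 * (A' * X) + C * X ^ 2 * (C * X ^ 2)).
  - eapply Rle_trans; [apply Rabs_triang|].
    apply Rplus_le_compat; [eapply Rle_trans; [apply Rabs_triang|]; apply Rplus_le_compat|];
      rewrite Rabs_mult; apply Rmult_le_compat; trivial; apply Rabs_pos.
  - assert (0 <= X ^ 3) by (apply pow_le; lra).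
    assert (X ^ 4 <= X ^ 3) by (simpl; nra).
    assert (C * C * X ^ 4 <= C * C * X ^ 3) by (apply Rmult_le_compat_l; nra).
    replace (A * X * (C * X ^ 2) + C * X ^ 2 * (A' * X) + C * X ^ 2 * (C * X ^ 2))
      with (C * (A + A') * X ^ 3 + C * C * X ^ 4) by ring.
    lra.
Qed.

(** The determinant is [E ^ 2 * N - S ^ 2 * k] up to a cubic error. Only continuity in [E] is
    assumed, so the root comes from a sign change between [e1 * |S| - L * S ^ 2] and
    [e1 * |S| + L * S ^ 2] instead of an implicit function argument. *)
Lemma perturbed_det_root (N1 N2 k1 k2 C r0 : R) :
  0 < N1 -> 0 < N2 -> 0 < k1 -> 0 < k2 -> 0 <= C -> 0 < r0 ->
  exists e1 s0 L : R, 0 < e1 /\ 0 < s0 /\ 0 < L /\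
  forall (S : R) (a11 a12 a21 a22 : R -> R), 0 < Rabs S < s0 ->
    (forall E, Rabs E < r0 ->
       Rabs (a11 E - E * N1) <= C * (Rabs E + Rabs S) ^ 2 /\
       Rabs (a12 E - S * k1) <= C * (Rabs E + Rabs S) ^ 2 /\
       Rabs (a21 E - S * k2) <= C * (Rabs E + Rabs S) ^ 2 /\
       Rabs (a22 E - E * N2) <= C * (Rabs E + Rabs S) ^ 2) ->
    (forall E, Rabs E < r0 ->
       continuity_pt (fun E => a11 E * a22 E - a12 E * a21 E) E) ->
    exists E, Rabs E < r0 /\ Rabs (E - e1 * Rabs S) <= L * S ^ 2 /\
      a11 E * a22 E - a12 E * a21 E = 0.
Proof.
  intros HN1 HN2 Hk1 Hk2 HC Hr0.
  set (N := N1 * N2). assert (HN : 0 < N) by (apply Rmult_lt_0_compat; trivial).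
  set (k := k1 * k2). assert (Hk : 0 < k) by (apply Rmult_lt_0_compat; trivial).
  assert (Hkn : 0 < k / N) by (apply Rdiv_lt_0_compat; trivial).
  set (e1 := sqrt (k / N)). assert (He1 : 0 < e1) by (apply sqrt_lt_R0; trivial).
  assert (Hee : e1 * e1 * N = k).
  { unfold e1. rewrite sqrt_sqrt by lra. field. lra. }
  set (C1 := C * (N1 + N2 + C) + C * (k1 + k2 + C)).
  assert (HC1 : 0 <= C1) by (unfold C1; nra).
  (* On the interval searched, [E <= 2 * e1 * ep], hence [E + ep <= (2 * e1 + 1) * ep]. *)
  set (C' := C1 * (2 * e1 + 1) ^ 3).
  assert (HC' : 0 <= C') by (apply Rmult_le_pos; [trivial|apply pow_le; lra]).
  (* Chosen so that moving [E] by [L * ep ^ 2] from [e1 * ep] changes the leading part by at least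
     [(C' + 1) * ep ^ 3], more than the error [C' * ep ^ 3]. *)
  set (L := (C' + 1) / (N * e1)).
  assert (HNe : 0 < N * e1) by (apply Rmult_lt_0_compat; trivial).
  assert (HL : 0 < L) by (apply Rdiv_lt_0_compat; lra).
  assert (HLN : N * e1 * L = C' + 1) by (unfold L; field; lra).
  (* The three bounds give, in this order, a positive left endpoint, [E + ep <= 1] for
     [product_error], and [E < r0]. *)
  exists e1. exists (Rmin (e1 / L) (Rmin (/ (2 * e1 + 1)) (r0 / (2 * e1 + 1)))). exists L.
  assert (Hi1 : 0 < e1 / L) by (apply Rdiv_lt_0_compat; trivial).
  assert (Hi2 : 0 < / (2 * e1 + 1)) by (apply Rinv_0_lt_compat; lra).
  assert (Hi3 : 0 < r0 / (2 * e1 + 1)) by (apply Rdiv_lt_0_compat; lra).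
  split; [trivial|]. split; [repeat apply Rmin_glb_lt; trivial|]. split; [trivial|].
  intros S a11 a12 a21 a22 HS Ha Hcont.
  set (ep := Rabs S) in *. destruct HS as [Hep HS].
  assert (H1 : ep < e1 / L) by (eapply Rlt_le_trans; [apply HS|apply Rmin_l]).
  assert (H23 : ep < Rmin (/ (2 * e1 + 1)) (r0 / (2 * e1 + 1)))
    by (eapply Rlt_le_trans; [apply HS|apply Rmin_r]).
  assert (H2 : ep < / (2 * e1 + 1)) by (eapply Rlt_le_trans; [apply H23|apply Rmin_l]).
  assert (H3 : ep < r0 / (2 * e1 + 1)) by (eapply Rlt_le_trans; [apply H23|apply Rmin_r]).
  assert (H1' : L * ep < e1).
  { apply Rmult_lt_compat_l with (r := L) in H1; [|trivial].
    replace (L * (e1 / L)) with e1 in H1 by (field; lra). trivial. }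
  assert (H2' : (2 * e1 + 1) * ep < 1).
  { apply Rmult_lt_compat_l with (r := 2 * e1 + 1) in H2; [|lra].
    rewrite Rinv_r in H2 by lra. trivial. }
  assert (H3' : (2 * e1 + 1) * ep < r0).
  { apply Rmult_lt_compat_l with (r := 2 * e1 + 1) in H3; [|lra].
    replace ((2 * e1 + 1) * (r0 / (2 * e1 + 1))) with r0 in H3 by (field; lra). trivial. }
  assert (HS2 : S ^ 2 = ep ^ 2) by (unfold ep; now rewrite pow2_abs).
  set (D := fun E => a11 E * a22 E - a12 E * a21 E).
  assert (HD : forall E, 0 <= E <= 2 * e1 * ep ->
    Rabs (D E - (E * E * N - ep ^ 2 * k)) <= C' * ep ^ 3).
  { intros E HE. assert (HabsE : Rabs E = E) by (apply Rabs_pos_eq; lra).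
    assert (HEr : Rabs E < r0) by (rewrite HabsE; nra).
    destruct (Ha E HEr) as [G1 [G2 [G3 G4]]]. rewrite HabsE in *.
    set (X := E + ep) in *.
    assert (HX : 0 <= X <= 1) by (unfold X; nra).
    assert (P1 : Rabs (a11 E * a22 E - E * N1 * (E * N2)) <= C * (N1 + N2 + C) * X ^ 3).
    { apply product_error; try lra; trivial; rewrite Rabs_mult, HabsE;
        unfold X; [rewrite (Rabs_pos_eq N1) by lra|rewrite (Rabs_pos_eq N2) by lra]; nra. }
    assert (P2 : Rabs (a12 E * a21 E - S * k1 * (S * k2)) <= C * (k1 + k2 + C) * X ^ 3).
    { apply product_error; try lra; trivial; rewrite Rabs_mult; fold ep;
        unfold X; [rewrite (Rabs_pos_eq k1) by lra|rewrite (Rabs_pos_eq k2) by lra]; nra. }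
    assert (HX3 : X ^ 3 <= (2 * e1 + 1) ^ 3 * ep ^ 3).
    { rewrite <- Rpow_mult_distr. apply pow_incr. unfold X. nra. }
    replace (D E - (E * E * N - ep ^ 2 * k)) with
      ((a11 E * a22 E - E * N1 * (E * N2)) - (a12 E * a21 E - S * k1 * (S * k2))).
    - eapply Rle_trans; [apply Rabs_triang|]. rewrite Rabs_Ropp.
      apply Rle_trans with (C1 * X ^ 3); [unfold C1; lra|].
      unfold C'. rewrite Rmult_assoc. now apply Rmult_le_compat_l.
    - rewrite <- HS2. unfold D, N, k. ring. }
  assert (Hep3 : 0 < ep ^ 3) by (apply pow_lt; trivial).
  set (x := e1 * ep - L * ep ^ 2). set (y := e1 * ep + L * ep ^ 2).
  assert (Hlep : 0 < L * ep ^ 2) by (apply Rmult_lt_0_compat; [trivial|apply pow_lt; trivial]).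
  assert (Hlep' : L * ep ^ 2 < e1 * ep) by (simpl; nra).
  destruct (IVT_interv D x y) as [E [HE HDE]].
  - intros E HE. apply Hcont. rewrite Rabs_pos_eq; unfold x, y in *; nra.
  - unfold x, y; lra.
  - assert (Hx0 : Rabs (D x - (x * x * N - ep ^ 2 * k)) <= C' * ep ^ 3)
      by (apply HD; unfold x; lra).
    apply Rabs_le_between in Hx0.
    assert (Hxx : x * x * N - ep ^ 2 * k <= - (C' + 1) * ep ^ 3).
    { rewrite <- Hee, <- HLN. unfold x.
      replace ((e1 * ep - L * ep ^ 2) * (e1 * ep - L * ep ^ 2) * N - ep ^ 2 * (e1 * e1 * N))
        with (- (N * L * ep ^ 3 * (2 * e1 - L * ep))) by ring.
      assert (0 < N * L * ep ^ 3) by (apply Rmult_lt_0_compat; [apply Rmult_lt_0_compat|]; trivial).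
      nra. }
    lra.
  - assert (Hy0 : Rabs (D y - (y * y * N - ep ^ 2 * k)) <= C' * ep ^ 3)
      by (apply HD; unfold y; lra).
    apply Rabs_le_between in Hy0.
    assert (Hyy : (C' + 1) * ep ^ 3 <= y * y * N - ep ^ 2 * k).
    { rewrite <- Hee, <- HLN. unfold y.
      replace ((e1 * ep + L * ep ^ 2) * (e1 * ep + L * ep ^ 2) * N - ep ^ 2 * (e1 * e1 * N))
        with (N * L * ep ^ 3 * (2 * e1 + L * ep)) by ring.
      assert (0 < N * L * ep ^ 3) by (apply Rmult_lt_0_compat; [apply Rmult_lt_0_compat|]; trivial).
      nra. }
    lra.
  - exists E. split; [|split].
    + rewrite Rabs_pos_eq; unfold x, y in *; nra.
    + rewrite HS2. apply Rabs_le. unfold x, y in *. lra.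
    + exact HDE.
Qed.

(** * The real interface system *)

(* [cG] and [cH] are auxiliary: to the right of the interface the second-order recursions for
   [cP] and [cS] are factored through [G n = P n - z1 * P (n-1)] and [H n = S (n+1) - zt2 * S n]. *)
Inductive comp := cA | cQ | cP | cG | cS | cH | cR | cY.

Definition state := comp -> Z -> R.

Section RealSystem.

Variables bp bm dp dm c : R.
Variables z1 zt2 : R.

Local Notation b := (coef_b bp bm).
Local Notation cc := (coef_c bp bm dp dm c).
Local Notation d := (coef_d bp bm dp dm c).

(** The second-neighbour coefficient that appears when [cR] and [cY] are eliminated at zero
    energy. *)
Definition coef_m (n : Z) : R := 2 * b n * b (n + 2)%Z / d n.

Local Notation mm := coef_m.

(** The sources collect the terms that vanish at [E = S = mu = 0]. Each is named after the unknown
    of its recursion, so [srcA] belongs to the row of [E * x cQ n], and [srcP] to that of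
    [E * x cS n]. The quotients of [b] by [d] come from eliminating [cR] and [cY]. *)
Definition srcA (E S mu : R) (x : state) (n : Z) : R :=
  E * x cQ n + cc n * (S * x cS (n + 1)%Z - mu * x cA (n + 1)%Z).
Definition srcQ (E S mu : R) (x : state) (n : Z) : R :=
  E * x cA n + cc (n - 1)%Z * (S * x cP (n - 1)%Z - mu * x cQ (n - 1)%Z).
Definition srcP (E S mu : R) (x : state) (n : Z) : R :=
  E * x cS n + cc (n - 1)%Z * (mu * x cP (n - 1)%Z + S * x cQ (n - 1)%Z)
  - E * (b n / d (n - 2)%Z) * x cY (n - 2)%Z.
Definition srcS (E S mu : R) (x : state) (n : Z) : R :=
  E * x cP n + cc n * (mu * x cS (n + 1)%Z + S * x cA (n + 1)%Z)
  - E * (b n / d n) * x cR (n + 2)%Z.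

(* Each row solves one equation of the system for the entry that makes it contracting at
   [E = S = mu = 0]; [mu] stands for [1 - cos (k / 2)].  The equations for [Q] and [S] at
   [n = 0] are the only ones that no row accounts for. *)
Definition sweep (E S mu : R) (x : state) : state := fun j n =>
  match j with
  | cA => if Z.leb 1 n then
            b (n - 1)%Z / cc (n - 1)%Z * x cA (n - 1)%Z
            - srcA E S mu x (n - 1) / cc (n - 1)%Z
          else if Z.eqb n 0 then 0
          else cc n / b n * x cA (n + 1)%Z + srcA E S mu x n / b n
  | cQ => if Z.leb 0 n then
            b (n + 1)%Z / cc n * x cQ (n + 1)%Z - srcQ E S mu x (n + 1) / cc n
          else cc (n - 1)%Z / b n * x cQ (n - 1)%Z + srcQ E S mu x n / b n
  | cP => if Z.leb 1 n then z1 * x cP (n - 1)%Z + x cG n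
          else if Z.eqb n 0 then 0
          else b (n + 2)%Z / mm n * x cP (n + 2)%Z + cc (n + 1)%Z / mm n * x cP (n + 1)%Z
               - srcP E S mu x (n + 2) / mm n
  | cG => if Z.leb 1 n then zt2 * x cG (n + 1)%Z - zt2 / bp * srcP E S mu x (n + 1)
          else 0
  | cS => if Z.leb 2 n then zt2 * x cS (n - 1)%Z + x cH (n - 1)%Z
          else b (n - 2)%Z / mm (n - 2) * x cS (n - 2)%Z
               + cc (n - 2)%Z / mm (n - 2) * x cS (n - 1)%Z
               - srcS E S mu x (n - 2) / mm (n - 2)
  | cH => if Z.leb 0 n then z1 * x cH (n + 1)%Z + z1 / mm n * srcS E S mu x n
          else 0
  | cR => - (2 * b (n - 2)%Z / d (n - 2)%Z) * x cP (n - 2)%Z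
          + E / d (n - 2)%Z * x cY (n - 2)%Z
  | cY => - (2 * b (n + 2)%Z / d n) * x cS (n + 2)%Z + E / d n * x cR (n + 2)%Z
  end.

Definition seed (t1 t2 : R) : state := fun j n =>
  match j with
  | cA => if Z.eqb n 0 then t1 else 0
  | cP => if Z.eqb n 0 then t2 else 0
  | _ => 0
  end.

Definition seed_sweep_solution E S mu t1 t2 x :=
  forall j n, x j n = seed t1 t2 j n + sweep E S mu x j n.

Lemma sweep_linear E S mu s t x y j n :
  sweep E S mu (fun i m => s * x i m + t * y i m) j n
  = s * sweep E S mu x j n + t * sweep E S mu y j n.
Proof.
  unfold sweep, srcA, srcQ, srcP, srcS, Rdiv.
  destruct j; repeat match goal with
    |- context [if ?e then _ else _] => destruct e end; ring.
Qed.

Lemma sweep_subtractive E S mu : subtractive (sweep E S mu).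
Proof.
  intros x y j n.
  unfold sweep, srcA, srcQ, srcP, srcS, Rdiv.
  destruct j; repeat match goal with
    |- context [if ?e then _ else _] => destruct e end; ring.
Qed.

Lemma coef_b_right n : (0 <= n)%Z -> b n = bp.
Proof. intros H. unfold coef_b. now rewrite (proj2 (Z.leb_le 0 n) H). Qed.

Lemma coef_b_left n : (n <= -1)%Z -> b n = bm.
Proof. intros H. unfold coef_b. destruct (Z.leb_spec 0 n); [lia|reflexivity]. Qed.

Lemma coef_c_right n : (0 <= n)%Z -> cc n = bp + dp.
Proof. intros H. unfold coef_c. now rewrite (proj2 (Z.leb_le 0 n) H). Qed.

Lemma coef_c_left n : (n <= -2)%Z -> cc n = bm + dm.
Proof.
  intros H. unfold coef_c. destruct (Z.leb_spec 0 n); [lia|].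
  destruct (Z.eqb_spec n (-1)); [lia|reflexivity].
Qed.

Lemma coef_d_right n : (0 <= n)%Z -> d n = bp + dp.
Proof. intros H. unfold coef_d. now rewrite (proj2 (Z.leb_le 0 n) H). Qed.

Lemma coef_d_left n : (n <= -3)%Z -> d n = bm + dm.
Proof.
  intros H. unfold coef_d. destruct (Z.leb_spec 0 n); [lia|].
  destruct (Z.leb_spec (-2) n); [lia|reflexivity].
Qed.

Hypotheses (hbp : 0 < bp) (hbm : 0 < bm) (hdp : 0 < bp + dp) (hdm : 0 < bm + dm)
  (hc : 0 < c).

Lemma coef_b_pos n : 0 < b n.
Proof. unfold coef_b. destruct (Z.leb 0 n); trivial. Qed.

Lemma coef_c_pos n : 0 < cc n.
Proof.
  unfold coef_c. destruct (Z.leb 0 n); trivial. destruct (Z.eqb n (-1)); trivial.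
Qed.

Lemma coef_d_pos n : 0 < d n.
Proof.
  unfold coef_d. destruct (Z.leb 0 n); trivial. destruct (Z.leb (-2) n); trivial.
Qed.

Lemma coef_m_pos n : 0 < mm n.
Proof.
  unfold coef_m. assert (H1 := coef_b_pos n). assert (H2 := coef_b_pos (n + 2)).
  assert (H3 := coef_d_pos n). apply Rdiv_lt_0_compat; trivial.
  apply Rmult_lt_0_compat; lra.
Qed.

Lemma coef_m_right n : (0 <= n)%Z -> mm n = 2 * bp * bp / (bp + dp).
Proof.
  intros H. unfold coef_m. rewrite !coef_b_right, coef_d_right by lia. reflexivity.
Qed.

(* [z1] is the root in (0,1) of [bp z^2 + cp z - m+]; [zt2] is the inverse of the other one. *)
Hypotheses (Hz1 : 0 < z1 < 1) (Hzt2 : -1 < zt2 < 0)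
  (Hroot : bp * z1 * z1 + (bp + dp) * z1 = 2 * bp * bp / (bp + dp))
  (Hroots : bp * z1 = - (2 * bp * bp / (bp + dp)) * zt2).

Section Solution.

Variables (E S mu t1 t2 : R) (x : state).
Hypothesis Hx : seed_sweep_solution E S mu t1 t2 x.

Lemma solution_A0 : x cA 0%Z = t1.
Proof. rewrite Hx. simpl. ring. Qed.

Lemma solution_P0 : x cP 0%Z = t2.
Proof. rewrite Hx. simpl. ring. Qed.

(** To the right, the equation at [n] is the row of the entry at [n + 1]; to the left, it is the row
    of the entry at [n]. The entry at 0 is the seed, so no equation is lost. *)
Lemma solution_A n :
  b n * x cA n - cc n * x cA (n + 1)%Z = srcA E S mu x n.
Proof.
  assert (H1 := coef_b_pos n). assert (H2 := coef_c_pos n).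
  destruct (Z_le_gt_dec 0 n) as [Hn|Hn].
  - rewrite (Hx cA (n + 1)%Z). unfold seed, sweep.
    destruct (Z.leb_spec 1 (n + 1)); [|lia]. destruct (Z.eqb_spec (n + 1) 0); [lia|].
    replace (n + 1 - 1)%Z with n by lia. field. lra.
  - rewrite (Hx cA n). unfold seed, sweep.
    destruct (Z.leb_spec 1 n); [lia|]. destruct (Z.eqb_spec n 0); [lia|].
    field. lra.
Qed.

Lemma solution_Q n : n <> 0%Z ->
  b n * x cQ n - cc (n - 1)%Z * x cQ (n - 1)%Z = srcQ E S mu x n.
Proof.
  intros Hn0. assert (H1 := coef_b_pos n). assert (H2 := coef_c_pos (n - 1)).
  destruct (Z_le_gt_dec 0 n) as [Hn|Hn].
  - rewrite (Hx cQ (n - 1)%Z). unfold seed, sweep.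
    destruct (Z.leb_spec 0 (n - 1)); [|lia].
    replace (n - 1 + 1)%Z with n by lia. field. lra.
  - rewrite (Hx cQ n). unfold seed, sweep.
    destruct (Z.leb_spec 0 n); [lia|]. field. lra.
Qed.

(** For [n >= 2] the left side factors as [bp * (G n - G (n-1) / zt2)], because
    [bp * z1 + (bp + dp) = - bp / zt2]. For [n <= 1] the equation is the row of the entry at
    [n - 2]. *)
Lemma solution_P n :
  b n * x cP n + cc (n - 1)%Z * x cP (n - 1)%Z - mm (n - 2) * x cP (n - 2)%Z
  = srcP E S mu x n.
Proof.
  destruct (Z_le_gt_dec 2 n) as [Hn|Hn].
  - rewrite (Hx cP n). unfold seed at 1, sweep at 1.
    destruct (Z.leb_spec 1 n); [|lia]. destruct (Z.eqb_spec n 0); [lia|].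
    rewrite (Hx cP (n - 1)%Z). unfold seed at 1 2, sweep at 1 2.
    destruct (Z.leb_spec 1 (n - 1)); [|lia]. destruct (Z.eqb_spec (n - 1) 0); [lia|].
    rewrite (Hx cG (n - 1)%Z). unfold seed at 1 2, sweep at 1 2.
    destruct (Z.leb_spec 1 (n - 1)); [|lia].
    replace (n - 1 + 1)%Z with n by lia. replace (n - 1 - 1)%Z with (n - 2)%Z by lia.
    rewrite coef_b_right, coef_c_right, coef_m_right by lia.
    set (m := 2 * bp * bp / (bp + dp)) in *.
    set (p := x cP (n - 2)%Z). set (g := x cG n). set (f := srcP E S mu x n).
    rewrite <- Hroot.
    assert (Hs : zt2 * (bp * z1 + (bp + dp)) = - bp).
    { apply Rmult_eq_reg_r with z1; [|lra].
      replace (zt2 * (bp * z1 + (bp + dp)) * z1) with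
        (zt2 * (bp * z1 * z1 + (bp + dp) * z1)) by ring.
      rewrite Hroot. replace (zt2 * m) with (- (- m * zt2)) by ring.
      rewrite <- Hroots. ring. }
    transitivity (bp * g + (zt2 * (bp * z1 + (bp + dp))) * (g - f / bp)).
    + field. lra.
    + rewrite Hs. field. lra.
  - rewrite (Hx cP (n - 2)%Z). unfold seed, sweep.
    destruct (Z.leb_spec 1 (n - 2)); [lia|]. destruct (Z.eqb_spec (n - 2) 0); [lia|].
    replace (n - 2 + 2)%Z with n by lia. replace (n - 2 + 1)%Z with (n - 1)%Z by lia.
    assert (Hm := coef_m_pos (n - 2)). field. lra.
Qed.

(** On the right [zt2] is a root of the reversed polynomial [bp + (bp + dp) * z - m * z ^ 2];
    splitting it off leaves a first-order operator in [cH] with ratio [z1]. *)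
Lemma solution_S n : n <> 0%Z ->
  b n * x cS n + cc n * x cS (n + 1)%Z - mm n * x cS (n + 2)%Z = srcS E S mu x n.
Proof.
  intros Hn0. destruct (Z_le_gt_dec 0 n) as [Hn|Hn].
  - rewrite (Hx cS (n + 2)%Z). unfold seed at 1, sweep at 1.
    destruct (Z.leb_spec 2 (n + 2)); [|lia].
    replace (n + 2 - 1)%Z with (n + 1)%Z by lia.
    rewrite (Hx cS (n + 1)%Z). unfold seed at 1 2, sweep at 1 2.
    destruct (Z.leb_spec 2 (n + 1)); [|lia].
    replace (n + 1 - 1)%Z with n by lia.
    rewrite (Hx cH n). unfold seed at 1 2, sweep at 1 2.
    destruct (Z.leb_spec 0 n); [|lia].
    rewrite coef_b_right, coef_c_right, coef_m_right by lia.
    assert (Hm : 0 < 2 * bp * bp / (bp + dp)).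
    { rewrite <- (coef_m_right 0) by lia. apply coef_m_pos. }
    set (m := 2 * bp * bp / (bp + dp)) in *.
    set (s := x cS n). set (h := x cH (n + 1)%Z). set (f := srcS E S mu x n).
    assert (Hs : bp + (bp + dp) * zt2 - m * zt2 * zt2 = 0).
    { apply Rmult_eq_reg_l with z1; [|lra].
      replace (z1 * (bp + (bp + dp) * zt2 - m * zt2 * zt2)) with
        (bp * z1 + zt2 * ((bp + dp) * z1) - m * zt2 * zt2 * z1) by ring.
      replace ((bp + dp) * z1) with (m - bp * z1 * z1) by lra.
      transitivity ((bp * z1 + m * zt2) * (1 - zt2 * z1)); [ring|].
      rewrite Hroots. ring. }
    assert (Hs2 : ((bp + dp) - m * zt2) * z1 = m).
    { replace (((bp + dp) - m * zt2) * z1) with ((bp + dp) * z1 + (- m * zt2) * z1) by ring.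
      rewrite <- Hroots. lra. }
    transitivity ((bp + (bp + dp) * zt2 - m * zt2 * zt2) * s
      + ((bp + dp) - m * zt2) * z1 * (h + f / m) - m * h).
    + field. lra.
    + rewrite Hs, Hs2. field. lra.
  - rewrite (Hx cS (n + 2)%Z). unfold seed, sweep.
    destruct (Z.leb_spec 2 (n + 2)); [lia|].
    replace (n + 2 - 2)%Z with n by lia. replace (n + 2 - 1)%Z with (n + 1)%Z by lia.
    assert (Hm := coef_m_pos n). field. lra.
Qed.

Lemma solution_R n : d n * x cR (n + 2)%Z = - 2 * b n * x cP n + E * x cY n.
Proof.
  rewrite (Hx cR). unfold seed, sweep. replace (n + 2 - 2)%Z with n by lia.
  assert (H := coef_d_pos n). field. lra.
Qed.

Lemma solution_Y n : d n * x cY n = - 2 * b (n + 2)%Z * x cS (n + 2)%Z + E * x cR (n + 2)%Z.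
Proof.
  rewrite (Hx cY). unfold seed, sweep. assert (H := coef_d_pos n). field. lra.
Qed.

End Solution.

Lemma solution_combine E S mu t1 t2 x y :
  seed_sweep_solution E S mu 1 0 x -> seed_sweep_solution E S mu 0 1 y ->
  seed_sweep_solution E S mu t1 t2 (fun j n => t1 * x j n + t2 * y j n).
Proof.
  intros H1 H2 j n. rewrite sweep_linear, (H1 j n), (H2 j n) at 1.
  unfold seed. destruct j; try destruct (Z.eqb n 0); ring.
Qed.

(** * Weights and contraction *)

Section Weights.

Variables rho eps B : R.
Hypotheses (Hrho : 0 < rho < 1) (Heps : 0 < eps <= 1)
  (HA : bp / (bp + dp) <= rho ^ 3) (HL : (bm + dm) / bm <= rho ^ 3)
  (HZ1 : z1 + eps <= rho ^ 3) (HZ2 : - zt2 + eps <= rho ^ 3)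
  (HB : 1 <= B) (HBb : forall n, b n <= B /\ / b n <= B)
  (HBc : forall n, cc n <= B /\ / cc n <= B)
  (HBd : forall n, d n <= B /\ / d n <= B).

(** Interface rows have coefficient sums of at most [B ^ 4]; the division by [rho ^ 2] more than
    pays for the contraction factor [rho]. *)
Definition wgtK : R := B ^ 4 / rho ^ 2.
(** At zero parameters the rows of [cR] and [cY] copy [cP] and [cS], shifted by two sites, with a
    factor of at most [2 * B ^ 2], and no other row reads them. Hence their weight can be taken as
    large as that copying demands. *)
Definition wgtL : R := 2 * B ^ 2 * wgtK ^ 2 * (/ rho ^ 2) ^ 2 / rho.
Definition wgtU : R := wgtK ^ 2 * / rho ^ 2 + wgtL.

Local Notation K := wgtK.
Local Notation L := wgtL.
Local Notation zp := (zpow rho).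

(* The powers of [K] absorb the finitely many interface coefficients that are not contracting. *)
Definition weight (j : comp) (n : Z) : R :=
  match j with
  | cA => if Z.leb 0 n then zp n else K * zp n
  | cQ => zp n
  | cP => if Z.leb 0 n then zp n else if Z.eqb n (-1) then K else K ^ 2 * zp (n + 2)
  | cG | cH => eps * zp n
  | cS => if Z.leb n (-1) then zp n else if Z.eqb n 0 then K else K ^ 2 * zp (n - 1)
  | cR | cY => L * zp n
  end.

Lemma B4_ge_1 : 1 <= B ^ 4.
Proof. rewrite <- (pow1 4). apply pow_incr. lra. Qed.

Lemma wgtK_spec : K * rho ^ 2 = B ^ 4.
Proof. unfold wgtK. field. lra. Qed.

Lemma rho_sq_lt : 0 < rho ^ 2 < 1.
Proof. split; [apply pow_lt; lra|]. simpl. nra. Qed.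

Lemma wgtK_ge_1 : 1 <= K.
Proof.
  assert (H := wgtK_spec). assert (H1 := B4_ge_1). assert (H2 := rho_sq_lt). nra.
Qed.

Lemma inv_rho_sq_ge_1 : 1 <= / rho ^ 2.
Proof.
  assert (H := rho_sq_lt). rewrite <- Rinv_1. apply Rinv_le_contravar; lra.
Qed.

Lemma B_sq_le : 1 <= B ^ 2.
Proof. rewrite <- (pow1 2). apply pow_incr. lra. Qed.

Lemma wgtL_spec : rho * L = 2 * B ^ 2 * (K ^ 2 * (/ rho ^ 2) * (/ rho ^ 2)).
Proof. unfold wgtL. field. lra. Qed.

Lemma wgtK_sq_ge : K <= K ^ 2.
Proof. assert (H := wgtK_ge_1). simpl. nra. Qed.

Lemma wgtL_ge_1 : 1 <= L.
Proof.
  assert (H := wgtL_spec). assert (H1 := wgtK_ge_1). assert (H2 := inv_rho_sq_ge_1).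
  assert (H3 := B_sq_le). assert (H4 := wgtK_sq_ge).
  assert (H5 : 1 <= K ^ 2 * / rho ^ 2) by nra.
  assert (H6 : 1 <= K ^ 2 * / rho ^ 2 * / rho ^ 2) by nra.
  assert (H7 : 1 <= rho * L) by (rewrite H; nra).
  nra.
Qed.

Lemma weightP_le n : weight cP n <= K ^ 2 * / rho ^ 2 * zp n.
Proof.
  assert (Hp := zpow_pos rho Hrho n). assert (HK := wgtK_ge_1). assert (HK2 := wgtK_sq_ge).
  assert (HQ := inv_rho_sq_ge_1).
  unfold weight. destruct (Z.leb_spec 0 n).
  - assert (1 <= K ^ 2 * / rho ^ 2) by nra. nra.
  - destruct (Z.eqb_spec n (-1)) as [->|Hn].
    + unfold zpow. simpl Z.abs_nat. rewrite pow_1.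
      assert (/ rho ^ 2 * rho = / rho) by (field; lra).
      assert (1 <= / rho) by (rewrite <- Rinv_1; apply Rinv_le_contravar; lra).
      rewrite Rmult_assoc, H0. nra.
    + rewrite Rmult_assoc. apply Rmult_le_compat_l; [nra|].
      apply zpow_near; trivial. lia.
Qed.

Lemma weightS_le n : weight cS n <= K ^ 2 * / rho ^ 2 * zp n.
Proof.
  assert (Hp := zpow_pos rho Hrho n). assert (HK := wgtK_ge_1). assert (HK2 := wgtK_sq_ge).
  assert (HQ := inv_rho_sq_ge_1).
  unfold weight. destruct (Z.leb_spec n (-1)).
  - assert (1 <= K ^ 2 * / rho ^ 2) by nra. nra.
  - destruct (Z.eqb_spec n 0) as [->|Hn].
    + unfold zpow. change (Z.abs_nat 0) with O. rewrite pow_O. nra.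
    + rewrite Rmult_assoc. apply Rmult_le_compat_l; [nra|].
      apply zpow_near; trivial. lia.
Qed.

Lemma weight_upper j n : weight j n <= wgtU * zp n.
Proof.
  assert (Hp := zpow_pos rho Hrho n). assert (HK := wgtK_ge_1). assert (HK2 := wgtK_sq_ge).
  assert (HQ := inv_rho_sq_ge_1). assert (HLL := wgtL_ge_1).
  assert (H1 : 1 <= K ^ 2 * / rho ^ 2) by nra.
  assert (H2 := weightP_le n). assert (H3 := weightS_le n).
  assert (H4 : K <= K ^ 2 * / rho ^ 2) by nra.
  unfold wgtU. set (V := K ^ 2 * / rho ^ 2) in *.
  destruct j; [|unfold weight; nra|nra|unfold weight; nra|nra|unfold weight; nra
    |unfold weight; nra|unfold weight; nra].
  unfold weight. destruct (Z.leb 0 n); [nra|].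
  apply Rmult_le_compat_r; nra.
Qed.

Lemma weight_lower j n : eps * zp n <= weight j n.
Proof.
  assert (Hp := zpow_pos rho Hrho n). assert (HK := wgtK_ge_1). assert (HK2 := wgtK_sq_ge).
  assert (HLL := wgtL_ge_1). assert (H1 := zpow_le_1 rho Hrho n).
  unfold weight; destruct j; try nra.
  - destruct (Z.leb 0 n); nra.
  - destruct (Z.leb_spec 0 n); [nra|]. destruct (Z.eqb_spec n (-1)); [nra|].
    assert (zp n <= zp (n + 2)) by (apply pow_decr; [trivial|lia]). nra.
  - destruct (Z.leb_spec n (-1)); [nra|]. destruct (Z.eqb_spec n 0); [nra|].
    assert (zp n <= zp (n - 1)) by (apply pow_decr; [trivial|lia]). nra.
Qed.

Lemma weight_pos j n : 0 < weight j n.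
Proof.
  assert (H := weight_lower j n). assert (Hp := zpow_pos rho Hrho n). nra.
Qed.

Lemma wbounded_decays M x j : 0 <= M -> wbounded weight M x ->
  decays rho (M * wgtU) (x j).
Proof.
  intros HM Hx n. apply Rle_trans with (1 := Hx j n). rewrite Rmult_assoc.
  apply Rmult_le_compat_l; trivial. apply weight_upper.
Qed.

Lemma row1_bound M a x w r : 0 <= M -> Rabs x <= M * w -> Rabs a * w <= r ->
  Rabs (a * x) <= M * r.
Proof.
  intros HM Hx Hr. rewrite Rabs_mult. assert (Ha := Rabs_pos a).
  apply Rle_trans with (Rabs a * (M * w)); [now apply Rmult_le_compat_l|].
  replace (Rabs a * (M * w)) with (M * (Rabs a * w)) by ring.
  now apply Rmult_le_compat_l.
Qed.

Lemma row2_bound M a1 a2 x1 x2 w1 w2 r : 0 <= M ->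
  Rabs x1 <= M * w1 -> Rabs x2 <= M * w2 -> Rabs a1 * w1 + Rabs a2 * w2 <= r ->
  Rabs (a1 * x1 + a2 * x2) <= M * r.
Proof.
  intros HM H1 H2 Hr. apply Rle_trans with (1 := Rabs_triang _ _).
  apply Rle_trans with (M * (Rabs a1 * w1) + M * (Rabs a2 * w2)).
  - apply Rplus_le_compat; apply row1_bound with (2 := H1) || apply row1_bound with (2 := H2);
      trivial; apply Rle_refl.
  - rewrite <- Rmult_plus_distr_l. now apply Rmult_le_compat_l.
Qed.

Lemma ratio_pos_le u v : 0 < u -> 0 < v -> u <= B -> / v <= B -> 0 < u / v <= B ^ 2.
Proof.
  intros Hu Hv H1 H2. assert (H3 := Rinv_0_lt_compat v Hv). split.
  - now apply Rdiv_lt_0_compat.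
  - unfold Rdiv. simpl. nra.
Qed.

Lemma inv_m_le n : 0 < / mm n <= B ^ 3 / 2.
Proof.
  assert (H1 := coef_b_pos n). assert (H2 := coef_b_pos (n + 2)).
  assert (H3 := coef_d_pos n). assert (H4 := coef_m_pos n).
  split; [now apply Rinv_0_lt_compat|].
  replace (/ mm n) with (d n * / b n * / b (n + 2)%Z / 2) by (unfold coef_m; field; lra).
  assert (Hi1 := Rinv_0_lt_compat _ H1). assert (Hi2 := Rinv_0_lt_compat _ H2).
  destruct (HBb n) as [_ H5]. destruct (HBb (n + 2)) as [_ H6]. destruct (HBd n) as [H7 _].
  apply Rmult_le_compat_r; [lra|].
  apply Rle_trans with (B * B * B); [|simpl; lra].
  apply Rmult_le_compat; [|lra| |trivial].
  - apply Rmult_le_pos; lra.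
  - apply Rmult_le_compat; lra.
Qed.

Lemma ratio_m_le u n : 0 < u <= B -> 0 < u / mm n <= B ^ 4 / 2.
Proof.
  intros Hu. assert (H := inv_m_le n). unfold Rdiv at 1 3. split; [nra|].
  apply Rle_trans with (B * (B ^ 3 / 2)); [apply Rmult_le_compat; lra|].
  simpl; lra.
Qed.

Lemma src_zero x n : srcA 0 0 0 x n = 0 /\ srcQ 0 0 0 x n = 0 /\
  srcP 0 0 0 x n = 0 /\ srcS 0 0 0 x n = 0.
Proof. unfold srcA, srcQ, srcP, srcS. repeat split; ring. Qed.

Lemma left_ratio : 0 < (bm + dm) / bm <= rho ^ 3.
Proof. split; [now apply Rdiv_lt_0_compat|trivial]. Qed.

Lemma ratio_m_left1 n : (n <= -3)%Z -> b (n + 2)%Z / mm n = (bm + dm) / bm / 2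
  /\ b n / mm n = (bm + dm) / bm / 2.
Proof.
  intros Hn. unfold coef_m. rewrite !coef_b_left, coef_d_left by lia. split; field; lra.
Qed.

Lemma ratio_m_left2 n i : (n <= -3)%Z -> (i <= -2)%Z ->
  cc i / mm n = ((bm + dm) / bm) ^ 2 / 2.
Proof.
  intros Hn Hi. unfold coef_m. rewrite !coef_b_left, coef_d_left, coef_c_left by lia.
  field; lra.
Qed.

Lemma rho_cube : 0 < rho ^ 3 < rho ^ 2.
Proof. assert (H := rho_sq_lt). simpl in *. nra. Qed.

Lemma shrink a u : a <= 1 -> 0 <= u -> a * u <= u.
Proof. intros. nra. Qed.

(** The factor 2 in [coef_m] halves both ratios of an interface row, so its two terms together cost
    no more than one. *)
Lemma half_sum_le a1 a2 X u v : 0 < a1 <= X / 2 -> 0 < a2 <= X / 2 ->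
  0 <= u <= v -> a1 * u + a2 * v <= X * v.
Proof. intros. nra. Qed.

Lemma interface_weight v : 0 <= v -> B ^ 4 * v <= rho * (K * v).
Proof.
  intros Hv. rewrite <- wgtK_spec. assert (HK := wgtK_ge_1).
  assert (0 <= K * v) by nra.
  replace (K * rho ^ 2 * v) with (rho * (rho * (K * v))) by ring.
  apply Rmult_le_compat_l; [lra|]. apply shrink; lra.
Qed.

Lemma weightP_interface : weight cP 1 = rho /\ weight cP 0 = 1 /\ weight cP (-1) = K /\
  weight cP (-2) = K ^ 2 /\ weight cP (-3) = rho * K ^ 2.
Proof. unfold weight, zpow. simpl. repeat split; ring. Qed.

Lemma weightS_interface : weight cS (-2) = rho ^ 2 /\ weight cS (-1) = rho /\
  weight cS 0 = K /\ weight cS 1 = K ^ 2.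
Proof. unfold weight, zpow. simpl. repeat split; ring. Qed.

Lemma row_RY_weight n m u v w : (Z.abs (n - m) <= 2)%Z -> 0 < w ->
  w <= K ^ 2 * / rho ^ 2 * zp m -> 0 < u -> 0 < v -> u <= B -> / v <= B ->
  Rabs (- (2 * u / v)) * w <= rho * (L * zp n).
Proof.
  intros Hnm Hw0 Hw Hu Hv Hu' Hv'.
  assert (Hr := ratio_pos_le u v Hu Hv Hu' Hv').
  replace (2 * u / v) with (2 * (u / v)) by (unfold Rdiv; ring).
  rewrite Rabs_Ropp, Rabs_pos_eq by lra.
  rewrite <- Rmult_assoc, wgtL_spec.
  assert (Hz := zpow_near rho Hrho n m Hnm).
  assert (HQ := inv_rho_sq_ge_1). assert (HK := wgtK_ge_1).
  assert (Hc : 0 <= K ^ 2 * / rho ^ 2) by nra.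
  apply Rle_trans with (2 * B ^ 2 * (K ^ 2 * / rho ^ 2 * (/ rho ^ 2 * zp n))).
  - apply Rmult_le_compat; try lra.
    apply Rle_trans with (1 := Hw). now apply Rmult_le_compat_l.
  - right. ring.
Qed.

(** A weighted row-sum test. In the bulk the cube in the hypotheses on [rho] pays for at most two
    sites of decay and for the contraction factor; at the interface the jumps of the weight by [K]
    do so. *)
Lemma sweep0_contractive : contractive weight rho (sweep 0 0 0).
Proof.
  intros M x HM Hx j n.
  assert (Hp := zpow_pos rho Hrho n). assert (HK := wgtK_ge_1). assert (HK2 := wgtK_sq_ge).
  assert (Hr2 := rho_sq_lt). assert (Hr3 := rho_cube). assert (HB4 := wgtK_spec).
  assert (Hlr := left_ratio). set (t := (bm + dm) / bm) in *.
  assert (Htt : t ^ 2 <= t) by (simpl; nra).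
  assert (HB4' := B4_ge_1).
  destruct weightP_interface as [WP1 [WP0 [WPm1 [WPm2 WPm3]]]].
  destruct weightS_interface as [WSm2 [WSm1 [WS0 WS1]]].
  rewrite (Rmult_comm rho M), Rmult_assoc.
  destruct j; unfold sweep.
  - destruct (Z.leb_spec 1 n).
    + rewrite (proj1 (src_zero x (n - 1))), Rdiv_0_l, Rminus_0_r.
      apply row1_bound with (2 := Hx cA (n - 1)%Z); trivial.
      rewrite coef_b_right, coef_c_right by lia.
      rewrite Rabs_pos_eq by (apply Rlt_le, Rdiv_lt_0_compat; lra).
      unfold weight. destruct (Z.leb_spec 0 (n - 1)); [|lia]. destruct (Z.leb_spec 0 n); [|lia].
      replace n with ((n - 1) + 1)%Z at 2 by lia. rewrite zpow_succ by lia.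
      assert (Hp' := zpow_pos rho Hrho (n - 1)). simpl in *. nra.
    + destruct (Z.eqb_spec n 0).
      * rewrite Rabs_R0. assert (Hw := weight_pos cA n). apply Rmult_le_pos; trivial. nra.
      * rewrite (proj1 (src_zero x n)), Rdiv_0_l, Rplus_0_r.
        apply row1_bound with (2 := Hx cA (n + 1)%Z); trivial.
        destruct (Z.eq_dec n (-1)) as [->|Hn].
        -- assert (Hr := ratio_pos_le (cc (-1)) (b (-1)) (coef_c_pos _) (coef_b_pos _)
             (proj1 (HBc _)) (proj2 (HBb _))).
           rewrite Rabs_pos_eq by lra.
           unfold weight, zpow. simpl Z.add. simpl Z.leb. cbv iota. simpl Z.abs_nat.
           rewrite pow_O, pow_1.
           assert (B ^ 2 <= B ^ 4) by (apply Rle_pow; [lra|lia]). simpl in *. nra.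
        -- rewrite coef_b_left, coef_c_left by lia. fold t. rewrite Rabs_pos_eq by lra.
           unfold weight. destruct (Z.leb_spec 0 (n + 1)); [lia|]. destruct (Z.leb_spec 0 n); [lia|].
           replace n with ((n + 1) - 1)%Z at 2 by lia. rewrite zpow_pred by lia.
           assert (Hp' := zpow_pos rho Hrho (n + 1)).
           assert (Hkp : 0 < K * zp (n + 1)) by nra.
           replace (rho * (K * (rho * zp (n + 1)))) with (rho ^ 2 * (K * zp (n + 1))) by ring.
           apply Rmult_le_compat_r; lra.
  - destruct (Z.leb_spec 0 n).
    + rewrite (proj1 (proj2 (src_zero x (n + 1)))), Rdiv_0_l, Rminus_0_r.
      apply row1_bound with (2 := Hx cQ (n + 1)%Z); trivial.
      rewrite coef_b_right, coef_c_right by lia.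
      rewrite Rabs_pos_eq by (apply Rlt_le, Rdiv_lt_0_compat; lra).
      unfold weight. rewrite zpow_succ by lia. apply shrink; [lra|nra].
    + rewrite (proj1 (proj2 (src_zero x n))), Rdiv_0_l, Rplus_0_r.
      apply row1_bound with (2 := Hx cQ (n - 1)%Z); trivial.
      rewrite coef_b_left, coef_c_left by lia. fold t. rewrite Rabs_pos_eq by lra.
      unfold weight. rewrite zpow_pred by lia. apply shrink; [lra|nra].
  - destruct (Z.leb_spec 1 n).
    (* The coefficient 1 of [cG] is harmless because its weight carries [eps], which fits between
       [z1] and [rho ^ 3]. *)
    + replace (z1 * x cP (n - 1)%Z + x cG n) with (z1 * x cP (n - 1)%Z + 1 * x cG n) by ring.
      apply row2_bound with (2 := Hx cP (n - 1)%Z) (3 := Hx cG n); trivial.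
      rewrite Rabs_R1, Rabs_pos_eq by lra.
      unfold weight. destruct (Z.leb_spec 0 (n - 1)); [|lia]. destruct (Z.leb_spec 0 n); [|lia].
      replace n with ((n - 1) + 1)%Z at 2 3 by lia. rewrite zpow_succ by lia.
      assert (Hp' := zpow_pos rho Hrho (n - 1)).
      replace (z1 * zp (n - 1) + 1 * (eps * (rho * zp (n - 1)))) with
        ((z1 + eps * rho) * zp (n - 1)) by ring.
      replace (rho * (rho * zp (n - 1))) with (rho ^ 2 * zp (n - 1)) by ring.
      apply Rmult_le_compat_r; nra.
    + destruct (Z.eqb_spec n 0).
      * rewrite Rabs_R0. assert (Hw := weight_pos cP n). apply Rmult_le_pos; trivial. nra.
      * rewrite (proj1 (proj2 (proj2 (src_zero x (n + 2))))), Rdiv_0_l, Rminus_0_r.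
        apply row2_bound with (2 := Hx cP (n + 2)%Z) (3 := Hx cP (n + 1)%Z); trivial.
        assert (HR1 := ratio_m_le (b (n + 2)%Z) n (conj (coef_b_pos _) (proj1 (HBb _)))).
        assert (HR2 := ratio_m_le (cc (n + 1)%Z) n (conj (coef_c_pos _) (proj1 (HBc _)))).
        rewrite !Rabs_pos_eq by lra.
        (* The rows at -1 and -2 involve interface coefficients, and at each of them the weight
           climbs by a factor [K]. From -3 on the two ratios are the bulk values [t / 2] and
           [t ^ 2 / 2]. *)
        destruct (Z.eq_dec n (-1)) as [->|Hn1];
          [|destruct (Z.eq_dec n (-2)) as [->|Hn2]].
        -- simpl Z.add in *. rewrite WP1, WP0, WPm1.
           replace (rho * K) with (rho * (K * 1)) by ring.
           eapply Rle_trans; [apply half_sum_le with (X := B ^ 4); lra|].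
           apply interface_weight; lra.
        -- simpl Z.add in *. rewrite WP0, WPm1, WPm2.
           replace (rho * K ^ 2) with (rho * (K * K)) by ring.
           eapply Rle_trans; [apply half_sum_le with (X := B ^ 4); lra|].
           apply interface_weight; lra.
        -- destruct (ratio_m_left1 n) as [HE1 _]; [lia|].
           rewrite HE1, (ratio_m_left2 n (n + 1)) by lia. fold t.
           destruct (Z.eq_dec n (-3)) as [->|Hn3].
           ++ simpl Z.add. rewrite WPm1, WPm2, WPm3.
              apply Rle_trans with (t * K ^ 2); [nra|].
              replace (rho * (rho * K ^ 2)) with (rho ^ 2 * K ^ 2) by ring.
              apply Rmult_le_compat_r; nra.
           ++ unfold weight. destruct (Z.leb_spec 0 (n + 2)); [lia|].
              destruct (Z.leb_spec 0 (n + 1)); [lia|]. destruct (Z.leb_spec 0 n); [lia|].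
              destruct (Z.eqb_spec (n + 2) (-1)); [lia|].
              destruct (Z.eqb_spec (n + 1) (-1)); [lia|].
              destruct (Z.eqb_spec n (-1)); [lia|].
              replace (n + 2)%Z with ((n + 2 + 2) - 1 - 1)%Z at 2 by lia.
              replace (n + 1 + 2)%Z with ((n + 2 + 2) - 1)%Z by lia.
              rewrite !zpow_pred by lia.
              assert (Hp' := zpow_pos rho Hrho (n + 2 + 2)).
              set (Z0 := zp (n + 2 + 2)) in *.
              assert (Hkp : 0 < K ^ 2 * Z0) by nra.
              replace (t / 2 * (K ^ 2 * Z0) + t ^ 2 / 2 * (K ^ 2 * (rho * Z0))) with
                ((t / 2 + t ^ 2 / 2 * rho) * (K ^ 2 * Z0)) by ring.
              replace (rho * (K ^ 2 * (rho * (rho * Z0)))) with (rho ^ 3 * (K ^ 2 * Z0)) by ring.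
              apply Rmult_le_compat_r; nra.
  - destruct (Z.leb_spec 1 n).
    + rewrite (proj1 (proj2 (proj2 (src_zero x (n + 1))))), Rmult_0_r, Rminus_0_r.
      apply row1_bound with (2 := Hx cG (n + 1)%Z); trivial.
      rewrite Rabs_left by lra. unfold weight. rewrite zpow_succ by lia.
      replace (eps * (rho * zp n)) with (rho * (eps * zp n)) by ring.
      assert (0 < eps * zp n) by nra. apply shrink; [lra|nra].
    + rewrite Rabs_R0. assert (Hw := weight_pos cG n). apply Rmult_le_pos; trivial. nra.
  - destruct (Z.leb_spec 2 n).
    + replace (zt2 * x cS (n - 1)%Z + x cH (n - 1)%Z) with
        (zt2 * x cS (n - 1)%Z + 1 * x cH (n - 1)%Z) by ring.
      apply row2_bound with (2 := Hx cS (n - 1)%Z) (3 := Hx cH (n - 1)%Z); trivial.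
      rewrite Rabs_R1, Rabs_left by lra.
      unfold weight. destruct (Z.leb_spec (n - 1) (-1)); [lia|].
      destruct (Z.eqb_spec (n - 1) 0); [lia|]. destruct (Z.leb_spec n (-1)); [lia|].
      destruct (Z.eqb_spec n 0); [lia|].
      replace (n - 1)%Z with ((n - 1 - 1) + 1)%Z at 2 3 by lia. rewrite zpow_succ by lia.
      assert (Hp' := zpow_pos rho Hrho (n - 1 - 1)).
      set (Z0 := zp (n - 1 - 1)) in *.
      replace (rho * (K ^ 2 * (rho * Z0))) with (rho ^ 2 * K ^ 2 * Z0) by ring.
      replace (- zt2 * (K ^ 2 * Z0) + 1 * (eps * (rho * Z0))) with
        ((- zt2 * K ^ 2 + eps * rho) * Z0) by ring.
      apply Rmult_le_compat_r; [lra|].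
      apply Rle_trans with ((- zt2 + eps) * K ^ 2); [|apply Rmult_le_compat_r; nra].
      assert (eps * rho <= eps * K ^ 2) by nra. lra.
    + rewrite (proj2 (proj2 (proj2 (src_zero x (n - 2))))), Rdiv_0_l, Rminus_0_r.
      apply row2_bound with (2 := Hx cS (n - 2)%Z) (3 := Hx cS (n - 1)%Z); trivial.
      assert (HR1 := ratio_m_le (b (n - 2)%Z) (n - 2) (conj (coef_b_pos _) (proj1 (HBb _)))).
      assert (HR2 := ratio_m_le (cc (n - 2)%Z) (n - 2) (conj (coef_c_pos _) (proj1 (HBc _)))).
      rewrite !Rabs_pos_eq by lra.
      (* The rows at 1 and 0 use the coefficients of sites -1 and -2; for [n <= -1] they are the
         left bulk values. *)
      destruct (Z.eq_dec n 1) as [->|Hn1]; [|destruct (Z.eq_dec n 0) as [->|Hn2]].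
      * simpl Z.sub in *. rewrite WSm1, WS0, WS1.
        replace (rho * K ^ 2) with (rho * (K * K)) by ring.
        eapply Rle_trans; [apply half_sum_le with (X := B ^ 4); lra|].
        apply interface_weight; lra.
      * simpl Z.sub in *. rewrite WSm2, WSm1, WS0.
        replace (rho * K) with (rho * (K * 1)) by ring.
        eapply Rle_trans; [apply half_sum_le with (X := B ^ 4); [lra|lra|simpl; nra]|].
        eapply Rle_trans; [|apply interface_weight; lra].
        apply Rmult_le_compat_l; lra.
      * destruct (ratio_m_left1 (n - 2)) as [_ HE1]; [lia|].
        rewrite HE1, (ratio_m_left2 (n - 2) (n - 2)) by lia. fold t.
        unfold weight. destruct (Z.leb_spec (n - 2) (-1)); [|lia].
        destruct (Z.leb_spec (n - 1) (-1)); [|lia]. destruct (Z.leb_spec n (-1)); [|lia].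
        replace (n - 2)%Z with (n - 1 - 1)%Z by lia. rewrite !zpow_pred by lia.
        replace (t / 2 * (rho * (rho * zp n)) + t ^ 2 / 2 * (rho * zp n)) with
          ((t / 2 * rho + t ^ 2 / 2) * (rho * zp n)) by ring.
        assert (0 < rho * zp n) by nra.
        rewrite <- (Rmult_1_l (rho * zp n)) at 2.
        apply Rmult_le_compat_r; nra.
  - destruct (Z.leb_spec 0 n).
    + rewrite (proj2 (proj2 (proj2 (src_zero x n)))), Rmult_0_r, Rplus_0_r.
      apply row1_bound with (2 := Hx cH (n + 1)%Z); trivial.
      rewrite Rabs_pos_eq by lra. unfold weight. rewrite zpow_succ by lia.
      replace (eps * (rho * zp n)) with (rho * (eps * zp n)) by ring.
      assert (0 < eps * zp n) by nra. apply shrink; [lra|nra].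
    + rewrite Rabs_R0. assert (Hw := weight_pos cH n). apply Rmult_le_pos; trivial. nra.
  - rewrite Rdiv_0_l, Rmult_0_l, Rplus_0_r.
    apply row1_bound with (2 := Hx cP (n - 2)%Z); trivial.
    apply row_RY_weight with (n - 2)%Z; [lia|apply weight_pos|apply weightP_le
      |apply coef_b_pos|apply coef_d_pos|apply HBb|apply HBd].
  - rewrite Rdiv_0_l, Rmult_0_l, Rplus_0_r.
    apply row1_bound with (2 := Hx cS (n + 2)%Z); trivial.
    apply row_RY_weight with (n + 2)%Z; [lia|apply weight_pos|apply weightS_le
      |apply coef_b_pos|apply coef_d_pos|apply HBb|apply HBd].
Qed.

(** * Dependence of the sweep and its solutions on the parameters *)

Local Notation psize E S mu := (Rabs E + Rabs S + Rabs mu).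

Definition nearU : R := wgtU * / rho ^ 2.
(** A row prefactor of at most [B ^ 3] times the [2 * B ^ 2] of [source_bound], with the cost of two
    shifts, divided by the smallest weight prefactor [eps]. *)
Definition lipK : R := 2 * B ^ 5 * nearU * / rho ^ 2 / eps.

Lemma wgtU_pos : 0 < wgtU.
Proof.
  assert (H := weight_upper cQ 0). assert (H1 := weight_pos cQ 0).
  unfold zpow in H. change (Z.abs_nat 0) with O in H. rewrite pow_O in H. lra.
Qed.

Lemma nearU_pos : 0 < nearU.
Proof.
  unfold nearU. assert (H := wgtU_pos). assert (H1 := inv_rho_sq_ge_1). nra.
Qed.

Lemma wbounded_near M x j n m : 0 <= M -> wbounded weight M x -> (Z.abs (n - m) <= 2)%Z ->
  Rabs (x j m) <= M * nearU * zp n.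
Proof.
  intros HM Hx Hnm. apply Rle_trans with (1 := Hx j m). unfold nearU.
  rewrite Rmult_assoc. apply Rmult_le_compat_l; trivial.
  apply Rle_trans with (1 := weight_upper j m). rewrite Rmult_assoc.
  apply Rmult_le_compat_l; [apply Rlt_le, wgtU_pos|]. now apply zpow_near.
Qed.

Lemma source_bound e s r g h u v w y X : 0 <= g <= B -> 0 <= h <= B ^ 2 ->
  Rabs u <= X -> Rabs v <= X -> Rabs w <= X -> Rabs y <= X ->
  Rabs (e * u + g * (s * v + r * w) - e * h * y)
    <= 2 * B ^ 2 * (Rabs e + Rabs s + Rabs r) * X.
Proof.
  intros Hg Hh Hu Hv Hw Hy.
  assert (HX : 0 <= X) by (apply Rle_trans with (2 := Hu); apply Rabs_pos).
  assert (He := Rabs_pos e). assert (Hs := Rabs_pos s). assert (Hr := Rabs_pos r).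
  assert (HB2 : B <= B ^ 2 /\ 1 <= B ^ 2) by (simpl; nra).
  assert (T1 : Rabs (e * u) <= Rabs e * X) by (rewrite Rabs_mult; now apply Rmult_le_compat_l).
  assert (T2 : Rabs (s * v) <= Rabs s * X) by (rewrite Rabs_mult; now apply Rmult_le_compat_l).
  assert (T3 : Rabs (r * w) <= Rabs r * X) by (rewrite Rabs_mult; now apply Rmult_le_compat_l).
  assert (T4 : Rabs (e * h * y) <= B ^ 2 * (Rabs e * X)).
  { rewrite 2!Rabs_mult, (Rabs_pos_eq h) by lra.
    replace (Rabs e * h * Rabs y) with (h * (Rabs e * Rabs y)) by ring.
    apply Rmult_le_compat; try lra; [apply Rmult_le_pos; [lra|apply Rabs_pos]|].
    now apply Rmult_le_compat_l. }
  assert (T5 : Rabs (g * (s * v + r * w)) <= B ^ 2 * (Rabs s * X + Rabs r * X)).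
  { rewrite Rabs_mult, (Rabs_pos_eq g) by lra.
    apply Rmult_le_compat; try lra; [apply Rabs_pos|].
    eapply Rle_trans; [apply Rabs_triang|]. lra. }
  eapply Rle_trans; [apply Rabs_triang|]. rewrite Rabs_Ropp.
  assert (T6 := Rabs_triang (e * u) (g * (s * v + r * w))).
  assert (T7 : Rabs e * X <= B ^ 2 * (Rabs e * X)).
  { assert (0 <= Rabs e * X) by (apply Rmult_le_pos; lra). nra. }
  assert (0 <= B ^ 2 * (Rabs s * X + Rabs r * X)).
  { apply Rmult_le_pos; [lra|]. apply Rplus_le_le_0_compat; apply Rmult_le_pos; lra. }
  nra.
Qed.

Lemma src_bound E S mu M x n : 0 <= M -> wbounded weight M x ->
  let V := 2 * B ^ 2 * psize E S mu * (M * nearU * zp n) in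
  Rabs (srcA E S mu x n) <= V /\ Rabs (srcQ E S mu x n) <= V /\
  Rabs (srcP E S mu x n) <= V /\ Rabs (srcS E S mu x n) <= V.
Proof.
  intros HM Hx V.
  assert (Hn : forall j m, (Z.abs (n - m) <= 2)%Z -> Rabs (x j m) <= M * nearU * zp n).
  { intros j m Hm. now apply wbounded_near. }
  assert (HX0 : Rabs 0 <= M * nearU * zp n).
  { rewrite Rabs_R0. assert (H := nearU_pos). assert (Hp := zpow_pos rho Hrho n).
    apply Rmult_le_pos; [apply Rmult_le_pos|]; lra. }
  assert (H0 : 0 <= 0 <= B ^ 2) by (simpl; nra).
  assert (Hc : forall m, 0 <= cc m <= B).
  { intros m. split; [apply Rlt_le, coef_c_pos|apply HBc]. }
  assert (Hbd : forall m m', 0 <= b m / d m' <= B ^ 2).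
  { intros m m'. assert (H := ratio_pos_le (b m) (d m') (coef_b_pos _) (coef_d_pos _)
      (proj1 (HBb _)) (proj2 (HBd _))). lra. }
  unfold V. repeat split.
  - replace (srcA E S mu x n) with (E * x cQ n
      + cc n * (S * x cS (n + 1)%Z + (- mu) * x cA (n + 1)%Z) - E * 0 * 0)
      by (unfold srcA; ring).
    rewrite <- (Rabs_Ropp mu). apply source_bound; trivial; apply Hn; lia.
  - replace (srcQ E S mu x n) with (E * x cA n
      + cc (n - 1)%Z * (S * x cP (n - 1)%Z + (- mu) * x cQ (n - 1)%Z) - E * 0 * 0)
      by (unfold srcQ; ring).
    rewrite <- (Rabs_Ropp mu). apply source_bound; trivial; apply Hn; lia.
  - replace (srcP E S mu x n) with (E * x cS n
      + cc (n - 1)%Z * (S * x cQ (n - 1)%Z + mu * x cP (n - 1)%Z)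
      - E * (b n / d (n - 2)%Z) * x cY (n - 2)%Z) by (unfold srcP; ring).
    apply source_bound; trivial; apply Hn; lia.
  - replace (srcS E S mu x n) with (E * x cP n
      + cc n * (S * x cA (n + 1)%Z + mu * x cS (n + 1)%Z)
      - E * (b n / d n) * x cR (n + 2)%Z) by (unfold srcS; ring).
    apply source_bound; trivial; apply Hn; lia.
Qed.

Lemma psize_nonneg E S mu : 0 <= psize E S mu.
Proof.
  assert (H1 := Rabs_pos E). assert (H2 := Rabs_pos S). assert (H3 := Rabs_pos mu). lra.
Qed.

Lemma lipK_nonneg : 0 <= lipK.
Proof.
  unfold lipK. assert (H := nearU_pos). assert (H1 := inv_rho_sq_ge_1).
  assert (0 <= B ^ 5) by (apply pow_le; lra).
  apply Rdiv_le_0_compat; [|lra].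
  apply Rmult_le_pos; [apply Rmult_le_pos; [apply Rmult_le_pos|]|]; lra.
Qed.

Lemma perturbation_entry E S mu M k f n m j : 0 <= M -> (Z.abs (n - m) <= 2)%Z ->
  Rabs k <= B ^ 3 -> Rabs f <= 2 * B ^ 2 * psize E S mu * (M * nearU * zp m) ->
  Rabs (k * f) <= lipK * psize E S mu * M * weight j n.
Proof.
  intros HM Hnm Hk Hf. rewrite Rabs_mult.
  assert (HP := psize_nonneg E S mu). set (P := psize E S mu) in *.
  assert (HU := nearU_pos). assert (HQ := inv_rho_sq_ge_1).
  assert (Hz := zpow_near rho Hrho n m Hnm). assert (Hpm := zpow_pos rho Hrho m).
  assert (HB3 : 0 <= B ^ 3) by (apply pow_le; lra).
  assert (HB2 := B_sq_le).
  assert (HPM : 0 <= P * M) by (apply Rmult_le_pos; trivial).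
  apply Rle_trans with (B ^ 3 * (2 * B ^ 2 * P * (M * nearU * (/ rho ^ 2 * zp n)))).
  - apply Rmult_le_compat; try apply Rabs_pos; trivial.
    eapply Rle_trans; [apply Hf|].
    apply Rmult_le_compat_l; [apply Rmult_le_pos; lra|].
    apply Rmult_le_compat_l; [apply Rmult_le_pos; lra|trivial].
  - replace (B ^ 3 * (2 * B ^ 2 * P * (M * nearU * (/ rho ^ 2 * zp n)))) with
      (lipK * P * M * (eps * zp n)) by (unfold lipK; field; lra).
    apply Rmult_le_compat_l; [|apply weight_lower].
    rewrite Rmult_assoc. apply Rmult_le_pos; [apply lipK_nonneg|trivial].
Qed.

Lemma inv_le_B3 v : 0 < v -> / v <= B -> Rabs (/ v) <= B ^ 3.
Proof.
  intros Hv HvB. assert (H := Rinv_0_lt_compat v Hv). rewrite Rabs_pos_eq by lra.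
  assert (HB2 := B_sq_le). simpl in *. nra.
Qed.

Lemma sweep_perturbation E S mu M x : 0 <= M -> wbounded weight M x ->
  wbounded weight (lipK * psize E S mu * M)
    (fun j n => sweep E S mu x j n - sweep 0 0 0 x j n).
Proof.
  intros HM Hx j n.
  assert (HP := psize_nonneg E S mu).
  assert (Hz : 0 <= lipK * psize E S mu * M * weight j n).
  { assert (H := lipK_nonneg). assert (Hw := weight_pos j n).
    apply Rmult_le_pos; [apply Rmult_le_pos; [apply Rmult_le_pos|]|]; lra. }
  assert (Hsrc := fun m => src_bound E S mu M x m HM Hx).
  assert (H0 := src_zero x).
  assert (Him : forall m, Rabs (/ mm m) <= B ^ 3).
  { intros m. assert (H := inv_m_le m). assert (0 <= B ^ 3) by (apply pow_le; lra).
    rewrite Rabs_pos_eq; lra. }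
  assert (Hib := fun m => inv_le_B3 (b m) (coef_b_pos m) (proj2 (HBb m))).
  assert (Hic := fun m => inv_le_B3 (cc m) (coef_c_pos m) (proj2 (HBc m))).
  assert (Hid := fun m => inv_le_B3 (d m) (coef_d_pos m) (proj2 (HBd m))).
  assert (Hbp : Rabs (/ bp) <= B ^ 3).
  { rewrite <- (coef_b_right 0) by lia. apply Hib. }
  assert (HE : forall i m, Rabs (E * x i m) <= 2 * B ^ 2 * psize E S mu * (M * nearU * zp m)).
  { intros i m. rewrite Rabs_mult. assert (HB2 := B_sq_le).
    apply Rmult_le_compat; try apply Rabs_pos; [|apply wbounded_near; trivial; lia].
    assert (H1 := Rabs_pos E). assert (H2 := Rabs_pos S). assert (H3 := Rabs_pos mu). nra. }
  destruct j; unfold sweep;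
    repeat match goal with |- context [if ?e then _ else _] => destruct e end;
    try (rewrite Rminus_diag, Rabs_R0; exact Hz).
  - rewrite (proj1 (H0 (n - 1)%Z)).
    match goal with |- Rabs ?e <= _ => replace e with
      ((- / cc (n - 1)%Z) * srcA E S mu x (n - 1)) by (unfold Rdiv; ring) end.
    apply perturbation_entry with (n - 1)%Z; trivial; [lia|rewrite Rabs_Ropp; apply Hic|apply Hsrc].
  - rewrite (proj1 (H0 n)).
    match goal with |- Rabs ?e <= _ => replace e with
      (/ b n * srcA E S mu x n) by (unfold Rdiv; ring) end.
    apply perturbation_entry with n; trivial; [lia|apply Hsrc].
  - rewrite (proj1 (proj2 (H0 (n + 1)%Z))).
    match goal with |- Rabs ?e <= _ => replace e with
      ((- / cc n) * srcQ E S mu x (n + 1)) by (unfold Rdiv; ring) end.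
    apply perturbation_entry with (n + 1)%Z; trivial; [lia|rewrite Rabs_Ropp; apply Hic|apply Hsrc].
  - rewrite (proj1 (proj2 (H0 n))).
    match goal with |- Rabs ?e <= _ => replace e with
      (/ b n * srcQ E S mu x n) by (unfold Rdiv; ring) end.
    apply perturbation_entry with n; trivial; [lia|apply Hsrc].
  - rewrite (proj1 (proj2 (proj2 (H0 (n + 2)%Z)))).
    match goal with |- Rabs ?e <= _ => replace e with
      ((- / mm n) * srcP E S mu x (n + 2)) by (unfold Rdiv; ring) end.
    apply perturbation_entry with (n + 2)%Z; trivial; [lia|rewrite Rabs_Ropp; apply Him|apply Hsrc].
  - rewrite (proj1 (proj2 (proj2 (H0 (n + 1)%Z)))).
    match goal with |- Rabs ?e <= _ => replace e with
      ((- (zt2 * / bp)) * srcP E S mu x (n + 1)) by (unfold Rdiv; ring) end.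
    apply perturbation_entry with (n + 1)%Z; trivial; [lia| |apply Hsrc].
    rewrite Rabs_Ropp, Rabs_mult. rewrite (Rabs_left zt2) by lra.
    eapply Rle_trans; [apply shrink; [lra|apply Rabs_pos]|trivial].
  - rewrite (proj2 (proj2 (proj2 (H0 (n - 2)%Z)))).
    match goal with |- Rabs ?e <= _ => replace e with
      ((- / mm (n - 2)) * srcS E S mu x (n - 2)) by (unfold Rdiv; ring) end.
    apply perturbation_entry with (n - 2)%Z; trivial; [lia|rewrite Rabs_Ropp; apply Him|apply Hsrc].
  - rewrite (proj2 (proj2 (proj2 (H0 n)))).
    match goal with |- Rabs ?e <= _ => replace e with
      ((z1 * / mm n) * srcS E S mu x n) by (unfold Rdiv; ring) end.
    apply perturbation_entry with n; trivial; [lia| |apply Hsrc].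
    rewrite Rabs_mult, (Rabs_pos_eq z1) by lra.
    eapply Rle_trans; [apply shrink; [lra|apply Rabs_pos]|apply Him].
  - match goal with |- Rabs ?e <= _ => replace e with
      (/ d (n - 2)%Z * (E * x cY (n - 2)%Z)) by (unfold Rdiv; ring) end.
    apply perturbation_entry with (n - 2)%Z; trivial. lia.
  - match goal with |- Rabs ?e <= _ => replace e with
      (/ d n * (E * x cR (n + 2)%Z)) by (unfold Rdiv; ring) end.
    apply perturbation_entry with (n + 2)%Z; trivial. lia.
Qed.

(** Since [sweep] is affine in its parameters, comparing two parameter values reduces to a
    perturbation of the zero parameters. *)
Lemma sweep_param_diff E S mu E' S' mu' x j n :
  sweep E S mu x j n - sweep E' S' mu' x j n
  = sweep (E - E') (S - S') (mu - mu') x j n - sweep 0 0 0 x j n.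
Proof.
  unfold sweep, srcA, srcQ, srcP, srcS, Rdiv.
  destruct j; repeat match goal with
    |- context [if ?e then _ else _] => destruct e end; ring.
Qed.

(** Halfway between [rho] and 1: [smallness] allows the perturbation to use up the remaining
    [(1 - rho) / 2]. *)
Definition lam0 : R := (1 + rho) / 2.
Definition smallness : R := (1 - rho) / 2 / (lipK + 1).

Lemma smallness_pos : 0 < smallness.
Proof.
  assert (H := lipK_nonneg). unfold smallness. apply Rdiv_lt_0_compat; lra.
Qed.

Lemma sweep_contractive E S mu : psize E S mu <= smallness ->
  contractive weight lam0 (sweep E S mu).
Proof.
  intros HP M x HM Hx j n.
  assert (H0 := sweep0_contractive M x HM Hx j n).
  assert (H1 := sweep_perturbation E S mu M x HM Hx j n). cbv beta in H1.
  assert (Hk : lipK * psize E S mu <= (1 - rho) / 2).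
  { assert (H := lipK_nonneg). assert (Hp := psize_nonneg E S mu).
    apply Rle_trans with ((lipK + 1) * smallness).
    - apply Rmult_le_compat; lra.
    - right. unfold smallness. field. lra. }
  assert (Hw := weight_pos j n).
  assert (HMw : 0 <= M * weight j n) by (apply Rmult_le_pos; lra).
  replace (sweep E S mu x j n) with
    (sweep 0 0 0 x j n + (sweep E S mu x j n - sweep 0 0 0 x j n)) by ring.
  eapply Rle_trans; [apply Rabs_triang|].
  apply Rle_trans with (rho * M * weight j n + (1 - rho) / 2 * (M * weight j n)).
  - apply Rplus_le_compat; [trivial|].
    eapply Rle_trans; [apply H1|]. rewrite Rmult_assoc.
    now apply Rmult_le_compat_r.
  - right. unfold lam0. field.
Qed.

Lemma lam0_range : 0 <= lam0 < 1.
Proof. unfold lam0. lra. Qed.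

Lemma seed_bounded t1 t2 : Rabs t1 <= 1 -> Rabs t2 <= 1 -> wbounded weight 1 (seed t1 t2).
Proof.
  intros H1 H2 j n. rewrite Rmult_1_l. assert (Hw := Rlt_le _ _ (weight_pos j n)).
  destruct j; unfold seed; try (rewrite Rabs_R0; exact Hw).
  - destruct (Z.eqb_spec n 0) as [->|]; [|rewrite Rabs_R0; exact Hw].
    unfold weight, zpow. simpl. trivial.
  - destruct (Z.eqb_spec n 0) as [->|]; [|rewrite Rabs_R0; exact Hw].
    unfold weight, zpow. simpl. trivial.
Qed.

Definition sol (t1 t2 E S mu : R) : state := neumann (sweep E S mu) (seed t1 t2).

Definition solM : R := 1 / (1 - lam0).

Lemma solM_pos : 0 < solM.
Proof. assert (H := lam0_range). unfold solM. apply Rdiv_lt_0_compat; lra. Qed.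

Definition is_unit_seed (t1 t2 : R) := Rabs t1 <= 1 /\ Rabs t2 <= 1.

Lemma sol_solution t1 t2 E S mu : is_unit_seed t1 t2 -> psize E S mu <= smallness ->
  seed_sweep_solution E S mu t1 t2 (sol t1 t2 E S mu).
Proof.
  intros [H1 H2] HP j n. unfold sol.
  apply neumann_fixed with (W := weight) (lam := lam0) (M := 1);
    [exact weight_pos|exact lam0_range|lra|now apply sweep_contractive
    |apply sweep_subtractive|now apply seed_bounded].
Qed.

Lemma sol_bounded t1 t2 E S mu : is_unit_seed t1 t2 -> psize E S mu <= smallness ->
  wbounded weight solM (sol t1 t2 E S mu).
Proof.
  intros [H1 H2] HP. unfold sol, solM.
  apply neumann_bounded;
    [exact lam0_range|lra|now apply sweep_contractive
    |apply sweep_subtractive|now apply seed_bounded].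
Qed.

Definition solLip : R := lipK * solM * solM.

Lemma solLip_nonneg : 0 <= solLip.
Proof.
  unfold solLip. assert (H := solM_pos). assert (H1 := lipK_nonneg).
  apply Rmult_le_pos; [apply Rmult_le_pos|]; lra.
Qed.

Lemma sol_lipschitz t1 t2 E S mu E' S' mu' : is_unit_seed t1 t2 ->
  psize E S mu <= smallness -> psize E' S' mu' <= smallness ->
  wbounded weight (solLip * psize (E - E') (S - S') (mu - mu'))
    (fun j n => sol t1 t2 E S mu j n - sol t1 t2 E' S' mu' j n).
Proof.
  intros [H1 H2] HP HP' j n.
  set (P := psize (E - E') (S - S') (mu - mu')).
  assert (HPn : 0 <= P) by apply psize_nonneg.
  replace (solLip * P) with (lipK * P * (1 / (1 - lam0)) / (1 - lam0)).
  - apply (neumann_lipschitz weight weight_pos (sweep E S mu) (sweep E' S' mu') (seed t1 t2));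
      [exact lam0_range|lra| |now apply sweep_contractive|now apply sweep_contractive
      |apply sweep_subtractive|apply sweep_subtractive|now apply seed_bounded|].
    + apply Rmult_le_pos; [apply lipK_nonneg|trivial].
    + intros x M' HM' Hx i m. rewrite sweep_param_diff. now apply sweep_perturbation.
  - assert (H := lam0_range). unfold solLip, solM. field. lra.
Qed.

Lemma psize_zero_small : psize 0 0 0 <= smallness.
Proof. assert (H := smallness_pos). rewrite Rabs_R0. lra. Qed.

Lemma unit_seed_10 : is_unit_seed 1 0.
Proof. split; [rewrite Rabs_R1|rewrite Rabs_R0]; lra. Qed.

Lemma unit_seed_01 : is_unit_seed 0 1.
Proof. split; [rewrite Rabs_R0|rewrite Rabs_R1]; lra. Qed.

(** * Zero modes and the residuals at the interface *)

Definition mode1 : state := sol 1 0 0 0 0.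
Definition mode2 : state := sol 0 1 0 0 0.

Lemma mode1_solution : seed_sweep_solution 0 0 0 1 0 mode1.
Proof. apply sol_solution; [exact unit_seed_10|exact psize_zero_small]. Qed.

Lemma mode2_solution : seed_sweep_solution 0 0 0 0 1 mode2.
Proof. apply sol_solution; [exact unit_seed_01|exact psize_zero_small]. Qed.

(** At zero parameters the rows of [cA] read only [cA], with nonnegative coefficients, so the
    iteration from this seed stays nonnegative and supported on [cA]. *)
Lemma mode1_sign j n : 0 <= mode1 j n /\ (j <> cA -> mode1 j n = 0).
Proof.
  assert (H : (True -> 0 <= mode1 j n) /\ (j <> cA -> mode1 j n <= 0)).
  { apply (neumann_sign weight (sweep 0 0 0) (seed 1 0) lam0 1)
      with (J1 := fun _ _ => True) (J2 := fun j _ => j <> cA);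
      [exact lam0_range|lra|apply sweep_contractive, psize_zero_small
      |apply sweep_subtractive|apply seed_bounded; apply unit_seed_10|].
    intros x Hx i m.
    assert (Hp : forall k, 0 <= x cA k) by (intros k; now apply Hx).
    assert (Hz : forall i k, i <> cA -> x i k = 0).
    { intros i' k Hi. apply Rle_antisym; now apply Hx. }
    assert (HA' : 0 <= seed 1 0 cA m + sweep 0 0 0 x cA m).
    { unfold seed, sweep. rewrite !(proj1 (src_zero x _)), !Rdiv_0_l.
      assert (Hb := coef_b_pos). assert (Hc := coef_c_pos).
      destruct (Z.leb_spec 1 m); [|destruct (Z.eqb_spec m 0); [lra|]];
        [destruct (Z.eqb_spec m 0); [lia|]|].
      - assert (0 <= b (m - 1)%Z / cc (m - 1)%Z * x cA (m - 1)%Z).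
        { apply Rmult_le_pos; [apply Rlt_le, Rdiv_lt_0_compat|]; trivial. }
        lra.
      - assert (0 <= cc m / b m * x cA (m + 1)%Z).
        { apply Rmult_le_pos; [apply Rlt_le, Rdiv_lt_0_compat|]; trivial. }
        lra. }
    assert (HZ : i <> cA -> seed 1 0 i m + sweep 0 0 0 x i m = 0).
    { intros Hi. unfold seed, sweep.
      destruct (src_zero x m) as [_ [Q1 [_ Q2]]].
      destruct (src_zero x (m + 1)) as [_ [Q3 [Q4 _]]].
      destruct (src_zero x (m + 2)) as [_ [_ [Q5 _]]].
      destruct (src_zero x (m - 2)) as [_ [_ [_ Q6]]].
      rewrite ?Q1, ?Q2, ?Q3, ?Q4, ?Q5, ?Q6.
      destruct i; [now destruct Hi|..];
        repeat match goal with |- context [if ?e then _ else _] => destruct e end;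
        rewrite ?Hz by discriminate; unfold Rdiv; ring. }
    destruct i; split; intros HJ; try (rewrite HZ by discriminate; lra);
      [exact HA'|now destruct HJ]. }
  split; [now apply H|]. intros Hj. apply Rle_antisym; now apply H.
Qed.

(** The negative [zt2] does no harm: at zero parameters [cG] is driven only by itself and stays
    zero. The remaining coefficients of the [cP] rows are nonnegative, and [cR] is a negative
    multiple of a shifted [cP]. *)
Lemma mode2_sign j n : 0 <= mode2 cP n /\ mode2 cR n <= 0 /\
  (j <> cP -> j <> cR -> mode2 j n = 0).
Proof.
  assert (H : forall j n, (j <> cR -> 0 <= mode2 j n) /\ (j <> cP -> mode2 j n <= 0)).
  { apply (neumann_sign weight (sweep 0 0 0) (seed 0 1) lam0 1)
      with (J1 := fun j _ => j <> cR) (J2 := fun j _ => j <> cP);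
      [exact lam0_range|lra|apply sweep_contractive, psize_zero_small
      |apply sweep_subtractive|apply seed_bounded; apply unit_seed_01|].
    intros x Hx i m.
    assert (Hp : forall k, 0 <= x cP k) by (intros k; now apply Hx).
    assert (Hz : forall i k, i <> cP -> i <> cR -> x i k = 0).
    { intros i' k Hi1 Hi2. apply Rle_antisym; now apply Hx. }
    assert (Hb := coef_b_pos). assert (Hc := coef_c_pos).
    assert (Hd := coef_d_pos). assert (Hm := coef_m_pos).
    assert (HP' : 0 <= seed 0 1 cP m + sweep 0 0 0 x cP m).
    { unfold seed, sweep.
      rewrite (proj1 (proj2 (proj2 (src_zero x (m + 2))))), !Rdiv_0_l.
      rewrite (Hz cG) by discriminate.
      destruct (Z.leb_spec 1 m); [|destruct (Z.eqb_spec m 0); [lra|]];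
        [destruct (Z.eqb_spec m 0); [lia|]|].
      - assert (0 <= z1 * x cP (m - 1)%Z) by (apply Rmult_le_pos; [lra|trivial]). lra.
      - assert (0 <= b (m + 2)%Z / mm m * x cP (m + 2)%Z).
        { apply Rmult_le_pos; [apply Rlt_le, Rdiv_lt_0_compat|]; trivial. }
        assert (0 <= cc (m + 1)%Z / mm m * x cP (m + 1)%Z).
        { apply Rmult_le_pos; [apply Rlt_le, Rdiv_lt_0_compat|]; trivial. }
        lra. }
    assert (HR' : seed 0 1 cR m + sweep 0 0 0 x cR m <= 0).
    { unfold seed, sweep.
      assert (0 <= 2 * b (m - 2)%Z / d (m - 2)%Z * x cP (m - 2)%Z).
      { apply Rmult_le_pos; [apply Rlt_le, Rdiv_lt_0_compat|]; trivial.
        assert (H := Hb (m - 2)%Z). lra. }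
      rewrite Rdiv_0_l. lra. }
    assert (HZ : i <> cP -> i <> cR -> seed 0 1 i m + sweep 0 0 0 x i m = 0).
    { intros Hi Hi2. unfold seed, sweep.
      destruct (src_zero x m) as [Q0 [Q1 [_ Q2]]].
      destruct (src_zero x (m + 1)) as [_ [Q3 [Q4 _]]].
      destruct (src_zero x (m - 1)) as [Q5 _].
      destruct (src_zero x (m - 2)) as [_ [_ [_ Q6]]].
      rewrite ?Q0, ?Q1, ?Q2, ?Q3, ?Q4, ?Q5, ?Q6.
      destruct i; try (now destruct Hi); try (now destruct Hi2);
        repeat match goal with |- context [if ?e then _ else _] => destruct e end;
        rewrite ?Hz by discriminate; unfold Rdiv; ring. }
    destruct i; split; intros HJ; try (rewrite HZ by discriminate; lra);
      first [exact HP'|exact HR'|now destruct HJ]. }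
  split; [now apply H|]. split; [now apply H|].
  intros Hj1 Hj2. apply Rle_antisym; now apply H.
Qed.

Local Notation phi := (mode1 cA).
Local Notation psi := (mode2 cP).

Lemma phi_0 : phi 0%Z = 1.
Proof. eapply solution_A0. exact mode1_solution. Qed.

Lemma psi_0 : psi 0%Z = 1.
Proof. eapply solution_P0. exact mode2_solution. Qed.

Lemma phi_relation n : cc n * phi (n + 1)%Z = b n * phi n.
Proof.
  assert (H := solution_A 0 0 0 1 0 mode1 mode1_solution n).
  rewrite (proj1 (src_zero _ _)) in H. lra.
Qed.

Lemma psi_relation n : b n * psi n + cc (n - 1)%Z * psi (n - 1)%Z
  = mm (n - 2) * psi (n - 2)%Z.
Proof.
  assert (H := solution_P 0 0 0 0 1 mode2 mode2_solution n).
  rewrite (proj1 (proj2 (proj2 (src_zero _ _)))) in H. lra.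
Qed.

Lemma mode1_bounded : wbounded weight solM mode1.
Proof. apply sol_bounded; [exact unit_seed_10|exact psize_zero_small]. Qed.

Lemma mode2_bounded : wbounded weight solM mode2.
Proof. apply sol_bounded; [exact unit_seed_01|exact psize_zero_small]. Qed.

Definition modeC : R := solM * wgtU.

Lemma modeC_pos : 0 < modeC.
Proof. apply Rmult_lt_0_compat; [exact solM_pos|exact wgtU_pos]. Qed.

Lemma phi_decays : decays rho modeC phi.
Proof. apply wbounded_decays; [apply Rlt_le, solM_pos|exact mode1_bounded]. Qed.

Lemma psi_decays : decays rho modeC psi.
Proof. apply wbounded_decays; [apply Rlt_le, solM_pos|exact mode2_bounded]. Qed.

(** * Pairing the interface residuals with the zero modes *)

Definition residQ (E S mu : R) (x : state) : R :=
  b 0%Z * x cQ 0%Z - cc (-1)%Z * x cQ (-1)%Z - srcQ E S mu x 0.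
Definition residS (E S mu : R) (x : state) : R :=
  b 0%Z * x cS 0%Z + cc 0%Z * x cS 1%Z - mm 0 * x cS 2%Z - srcS E S mu x 0.

Lemma decays_bounded_coef G M g x : 0 <= M -> (forall n, Rabs (g n) <= G) ->
  decays rho M x -> decays rho (G * M) (fun n => g n * x n).
Proof.
  intros HM Hg Hx n. rewrite Rabs_mult, Rmult_assoc.
  apply Rmult_le_compat; try apply Rabs_pos; [apply Hg|apply Hx].
Qed.

(* Summation by parts against the zero mode: every residual but the one at [n = 0] vanishes. *)
Lemma residQ_pairing E S mu t1 t2 x M : 0 <= M -> wbounded weight M x ->
  seed_sweep_solution E S mu t1 t2 x ->
  residQ E S mu x = - Zsum (fun n => phi n * srcQ E S mu x n).
Proof.
  intros HM Hb Hx.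
  assert (HMU : 0 <= M * wgtU) by (apply Rmult_le_pos; [trivial|apply Rlt_le, wgtU_pos]).
  rewrite (Zsum_telescope rho Hrho (B * (modeC * (M * wgtU)))
             (fun n => b n * (phi n * x cQ n))).
  - assert (H := phi_relation (-1)). simpl Z.add in H.
    rewrite phi_0 in *. unfold residQ.
    replace (b (-1)%Z * (phi (-1)%Z * x cQ (-1)%Z)) with
      (b (-1)%Z * phi (-1)%Z * x cQ (-1)%Z) by ring.
    rewrite <- H. ring.
  - apply decays_bounded_coef.
    + apply Rmult_le_pos; [apply Rlt_le, modeC_pos|trivial].
    + intros n. rewrite Rabs_pos_eq by (apply Rlt_le, coef_b_pos). apply HBb.
    + apply decays_mult; trivial; [apply Rlt_le, modeC_pos|exact phi_decays|].
      now apply wbounded_decays.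
  - intros n Hn. rewrite <- (solution_Q E S mu t1 t2 x Hx n Hn).
    assert (H := phi_relation (n - 1)). replace (n - 1 + 1)%Z with n in H by lia.
    transitivity (b n * (phi n * x cQ n) - (cc (n - 1)%Z * phi n) * x cQ (n - 1)%Z); [ring|].
    rewrite H. ring.
Qed.

Lemma coef_m_le n : Rabs (mm n) <= 2 * B ^ 3.
Proof.
  rewrite Rabs_pos_eq by (apply Rlt_le, coef_m_pos).
  replace (mm n) with (2 * b n * b (n + 2)%Z * / d n) by reflexivity.
  assert (H1 := coef_b_pos n). assert (H2 := coef_b_pos (n + 2)).
  assert (H3 := Rinv_0_lt_compat _ (coef_d_pos n)).
  destruct (HBb n) as [H4 _]. destruct (HBb (n + 2)) as [H5 _]. destruct (HBd n) as [_ H6].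
  apply Rle_trans with (2 * B * B * B); [|simpl; lra].
  apply Rmult_le_compat; try lra; [apply Rmult_le_pos; lra|].
  apply Rmult_le_compat; lra.
Qed.

(** As for [residQ], since the recursion of [psi] is the adjoint of the one for [cS]. The operator
    is of second order, so the boundary term consists of three products. *)
Lemma residS_pairing E S mu t1 t2 x M : 0 <= M -> wbounded weight M x ->
  seed_sweep_solution E S mu t1 t2 x ->
  residS E S mu x = - Zsum (fun n => psi n * srcS E S mu x n).
Proof.
  intros HM Hb Hx.
  assert (HMU : 0 <= M * wgtU) by (apply Rmult_le_pos; [trivial|apply Rlt_le, wgtU_pos]).
  assert (HmC := modeC_pos). assert (HQ := inv_rho_sq_ge_1).
  assert (Hs := wbounded_decays M x cS HM Hb).
  assert (Hs1 := decays_near rho Hrho _ _ 1 ltac:(lia) HMU Hs).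
  assert (Hs2 := decays_near rho Hrho _ _ 2 ltac:(lia) HMU Hs).
  assert (Hpm := decays_near rho Hrho _ _ (-1) ltac:(lia) (Rlt_le _ _ HmC) psi_decays).
  assert (HQM : 0 <= / rho ^ 2 * (M * wgtU)) by (apply Rmult_le_pos; lra).
  assert (HQC : 0 <= / rho ^ 2 * modeC) by (apply Rmult_le_pos; lra).
  assert (D1 := decays_mult rho Hrho _ _ _ _ (Rlt_le _ _ HmC) HQM psi_decays Hs1).
  assert (D2 := decays_mult rho Hrho _ _ _ _ (Rlt_le _ _ HmC) HQM psi_decays Hs2).
  assert (D3 := decays_mult rho Hrho _ _ _ _ HQC HQM Hpm Hs1).
  assert (P1 : 0 <= modeC * (/ rho ^ 2 * (M * wgtU))) by (apply Rmult_le_pos; lra).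
  assert (P3 : 0 <= / rho ^ 2 * modeC * (/ rho ^ 2 * (M * wgtU))) by (apply Rmult_le_pos; lra).
  assert (F1 := decays_bounded_coef B _ (fun n => cc n) _ P1
    (fun n => eq_ind_r (fun z => z <= B) (proj1 (HBc n))
       (Rabs_pos_eq _ (Rlt_le _ _ (coef_c_pos n)))) D1).
  assert (F2 := decays_bounded_coef _ _ (fun n => mm n) _ P1 coef_m_le D2).
  assert (F3 := decays_bounded_coef _ _ (fun n => mm (n - 1)) _ P3
    (fun n => coef_m_le (n - 1)) D3).
  set (C1 := B * (modeC * (/ rho ^ 2 * (M * wgtU)))) in *.
  set (C2 := 2 * B ^ 3 * (modeC * (/ rho ^ 2 * (M * wgtU)))) in *.
  set (C3 := 2 * B ^ 3 * (/ rho ^ 2 * modeC * (/ rho ^ 2 * (M * wgtU)))) in *.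
  rewrite (Zsum_telescope rho Hrho (C1 + C2 + C3)
    (fun n => cc n * (psi n * x cS (n + 1)%Z) - mm n * (psi n * x cS (n + 2)%Z)
              - mm (n - 1) * (psi (n + -1)%Z * x cS (n + 1)%Z))).
  - assert (H := psi_relation 0). simpl Z.sub in *. simpl Z.add in *.
    rewrite psi_0 in *. unfold residS.
    transitivity (b 0%Z * 1 * x cS 0%Z + cc 0%Z * x cS 1%Z - mm 0 * x cS 2%Z
      - srcS E S mu x 0); [ring|].
    replace (b 0%Z * 1) with (mm (-2) * psi (-2)%Z - cc (-1)%Z * psi (-1)%Z) by lra.
    ring.
  - intros n. specialize (F1 n). specialize (F2 n). specialize (F3 n). cbv beta in *.
    set (u := cc n * (psi n * x cS (n + 1)%Z)) in *.
    set (v := mm n * (psi n * x cS (n + 2)%Z)) in *.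
    set (w := mm (n - 1) * (psi (n + -1)%Z * x cS (n + 1)%Z)) in *.
    assert (T1 := Rabs_triang (u - v) (- w)). assert (T2 := Rabs_triang u (- v)).
    rewrite Rabs_Ropp in T1, T2.
    change (u - v - w) with (u - v + - w). change (u - v) with (u + - v) in *. lra.
  - intros n Hn. rewrite <- (solution_S E S mu t1 t2 x Hx n Hn).
    assert (H := psi_relation n).
    replace (n + -1)%Z with (n - 1)%Z by lia.
    replace (n - 1 + 1)%Z with n by lia. replace (n - 1 + 2)%Z with (n + 1)%Z by lia.
    replace (n - 1 - 1)%Z with (n - 2)%Z by lia. replace (n - 1 + -1)%Z with (n - 2)%Z by lia.
    transitivity (b n * psi n * x cS n + psi n * (cc n * x cS (n + 1)%Z)
      - psi n * (mm n * x cS (n + 2)%Z)); [ring|].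
    replace (b n * psi n) with (mm (n - 2) * psi (n - 2)%Z - cc (n - 1)%Z * psi (n - 1)%Z) by lra.
    ring.
Qed.

Lemma Zsum_ext x y : (forall n, x n = y n) -> Zsum x = Zsum y.
Proof. intros H. unfold Zsum. f_equal; apply Series_ext; intros; apply H. Qed.

Lemma pairing_decays g src P M : 0 <= M -> 0 <= P -> decays rho modeC g ->
  (forall n, Rabs (src n) <= 2 * B ^ 2 * P * (M * nearU * zp n)) ->
  decays rho (modeC * (2 * B ^ 2 * P * (M * nearU))) (fun n => g n * src n).
Proof.
  intros HM HP Hg Hsrc. assert (HU := nearU_pos). assert (HB2 := B_sq_le).
  apply decays_mult; trivial.
  - apply Rlt_le, modeC_pos.
  - apply Rmult_le_pos; apply Rmult_le_pos; lra.
  - intros n. rewrite Rmult_assoc. exact (Hsrc n).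
Qed.

Definition pairC : R := 2 * (modeC * (2 * B ^ 2 * (solLip * nearU))) / (1 - rho).

Lemma pairC_nonneg : 0 <= pairC.
Proof.
  assert (H := modeC_pos). assert (H1 := solLip_nonneg). assert (H2 := nearU_pos).
  assert (HB2 := B_sq_le). unfold pairC. apply Rdiv_le_0_compat; [|lra].
  apply Rmult_le_pos; [lra|]. apply Rmult_le_pos; [lra|].
  apply Rmult_le_pos; [lra|]. apply Rmult_le_pos; lra.
Qed.

(** The source is of size [P] relative to its argument and the argument changes by a multiple of
    [P], so replacing a solution by its zero mode costs only [P ^ 2]. *)
Lemma pairing_error g (src : state -> Z -> R) P x y : 0 <= P -> decays rho modeC g ->
  (forall M z n, 0 <= M -> wbounded weight M z ->
     Rabs (src z n) <= 2 * B ^ 2 * P * (M * nearU * zp n)) ->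
  (forall z z' n, src (fun j m => z j m - z' j m) n = src z n - src z' n) ->
  wbounded weight solM x -> wbounded weight solM y ->
  wbounded weight (solLip * P) (fun j m => x j m - y j m) ->
  Rabs (Zsum (fun n => g n * src x n) - Zsum (fun n => g n * src y n)) <= pairC * P ^ 2.
Proof.
  intros HP Hg Hsrc Hlin Hx Hy Hxy.
  assert (HsM := Rlt_le _ _ solM_pos).
  assert (HLP : 0 <= solLip * P) by (apply Rmult_le_pos; [exact solLip_nonneg|trivial]).
  rewrite <- (Zsum_minus rho Hrho (modeC * (2 * B ^ 2 * P * (solM * nearU)))
    (modeC * (2 * B ^ 2 * P * (solM * nearU))));
    [|apply pairing_decays; trivial; intros; now apply Hsrc
     |apply pairing_decays; trivial; intros; now apply Hsrc].
  rewrite (Zsum_ext _ (fun n => g n * src (fun j m => x j m - y j m) n))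
    by (intros; rewrite Hlin; ring).
  eapply Rle_trans; [apply decays_Zsum with (rho := rho); trivial;
    apply pairing_decays with (M := solLip * P) (P := P); trivial; intros; now apply Hsrc|].
  right. unfold pairC. field. lra.
Qed.

Definition normA : R := Zsum (fun n => phi n * srcQ 1 0 0 mode1 n).
Definition crossQ : R := Zsum (fun n => phi n * srcQ 0 1 0 mode2 n).
Definition crossS : R := Zsum (fun n => psi n * srcS 0 1 0 mode1 n).
Definition normP : R := Zsum (fun n => psi n * srcS 1 0 0 mode2 n).

(** In these two sources [mu] multiplies only components that vanish in the mode. It therefore
    enters at second order, and a bound of [mu] by [|S|] will be enough. *)
Lemma mode1_src E S mu n : srcQ E S mu mode1 n = E * phi n /\
  srcS E S mu mode1 n = S * (cc n * phi (n + 1)%Z).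
Proof.
  assert (H := fun j m => proj2 (mode1_sign j m)).
  unfold srcQ, srcS.
  rewrite (H cP (n - 1)%Z), (H cQ (n - 1)%Z), (H cP n), (H cS (n + 1)%Z), (H cR (n + 2)%Z)
    by discriminate.
  split; ring.
Qed.

Lemma mode2_src E S mu n : srcQ E S mu mode2 n = S * (cc (n - 1)%Z * psi (n - 1)%Z) /\
  srcS E S mu mode2 n = E * (psi n - b n / d n * mode2 cR (n + 2)%Z).
Proof.
  assert (H := fun j m => proj2 (proj2 (mode2_sign j m))).
  unfold srcQ, srcS.
  rewrite (H cA n), (H cQ (n - 1)%Z), (H cS (n + 1)%Z), (H cA (n + 1)%Z) by discriminate.
  split; ring.
Qed.

Lemma phi_1_pos : 0 < phi 1%Z.
Proof.
  assert (H := phi_relation 0). simpl Z.add in H. rewrite phi_0 in H.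
  assert (H1 := coef_b_pos 0). assert (H2 := coef_c_pos 0). nra.
Qed.

(** All terms of the four sums are nonnegative, so one strictly positive term near the interface
    suffices; it comes from the normalisation of both modes at site 0. *)
Lemma leading_pos : 0 < normA /\ 0 < crossQ /\ 0 < crossS /\ 0 < normP.
Proof.
  assert (Hf := fun n => proj1 (mode1_sign cA n)).
  assert (Hp := fun n => proj1 (mode2_sign cP n)).
  assert (Hr := fun n => proj1 (proj2 (mode2_sign cP n))).
  assert (Hc := coef_c_pos). assert (Hb := coef_b_pos). assert (Hd := coef_d_pos).
  assert (HsM := Rlt_le _ _ solM_pos).
  assert (D : forall E S mu g x, decays rho modeC g -> wbounded weight solM x ->
    decays rho (modeC * (2 * B ^ 2 * psize E S mu * (solM * nearU)))
      (fun n => g n * srcQ E S mu x n) /\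
    decays rho (modeC * (2 * B ^ 2 * psize E S mu * (solM * nearU)))
      (fun n => g n * srcS E S mu x n)).
  { intros E S mu g x Hg Hx. split; apply pairing_decays; trivial;
      try apply psize_nonneg; intros n; now apply src_bound. }
  assert (F1 := phi_1_pos).
  repeat split.
  - apply Zsum_pos with (rho := rho) (1 := Hrho) (2 := proj1 (D 1 0 0 _ _ phi_decays mode1_bounded))
      (m := O).
    + intros n. rewrite (proj1 (mode1_src 1 0 0 n)).
      apply Rmult_le_pos; [apply Hf|]. specialize (Hf n). lra.
    + rewrite (proj1 (mode1_src _ _ _ _)). change (Z.of_nat 0) with 0%Z. rewrite phi_0. lra.
  (* Site 1 gives [phi 1 * cc 0 * psi 0]; the term at site 0 would involve [psi (-1)], known here
     only to be nonnegative. *)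
  - apply Zsum_pos with (rho := rho) (1 := Hrho) (2 := proj1 (D 0 1 0 _ _ phi_decays mode2_bounded))
      (m := 1%nat).
    + intros n. rewrite (proj1 (mode2_src 0 1 0 n)), Rmult_1_l.
      apply Rmult_le_pos; [apply Hf|]. apply Rmult_le_pos; [apply Rlt_le, Hc|apply Hp].
    + rewrite (proj1 (mode2_src _ _ _ _)). change (Z.of_nat 1) with 1%Z. simpl Z.sub.
      rewrite psi_0, Rmult_1_l, Rmult_1_r. apply Rmult_lt_0_compat; [trivial|apply Hc].
  - apply Zsum_pos with (rho := rho) (1 := Hrho) (2 := proj2 (D 0 1 0 _ _ psi_decays mode1_bounded))
      (m := O).
    + intros n. rewrite (proj2 (mode1_src 0 1 0 n)), Rmult_1_l.
      apply Rmult_le_pos; [apply Hp|]. apply Rmult_le_pos; [apply Rlt_le, Hc|apply Hf].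
    + rewrite (proj2 (mode1_src _ _ _ _)). change (Z.of_nat 0) with 0%Z. simpl Z.add.
      rewrite psi_0, !Rmult_1_l. apply Rmult_lt_0_compat; [apply Hc|trivial].
  (* The elimination of [cR] enters the source with a minus sign, which the sign of [cR] in the mode
     turns into a nonnegative contribution. *)
  - assert (Hbr : forall n, 0 <= - (b n / d n * mode2 cR (n + 2)%Z)).
    { intros n. rewrite Ropp_mult_distr_r. apply Rmult_le_pos.
      - apply Rlt_le, Rdiv_lt_0_compat; trivial.
      - specialize (Hr (n + 2)%Z). lra. }
    apply Zsum_pos with (rho := rho) (1 := Hrho) (2 := proj2 (D 1 0 0 _ _ psi_decays mode2_bounded))
      (m := O).
    + intros n. rewrite (proj2 (mode2_src 1 0 0 n)), Rmult_1_l.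
      apply Rmult_le_pos; [apply Hp|]. specialize (Hp n). specialize (Hbr n). lra.
    + rewrite (proj2 (mode2_src _ _ _ _)). change (Z.of_nat 0) with 0%Z.
      rewrite psi_0, !Rmult_1_l. specialize (Hbr 0%Z). lra.
Qed.

Lemma srcQ_sub E S mu z z' n : srcQ E S mu (fun j m => z j m - z' j m) n
  = srcQ E S mu z n - srcQ E S mu z' n.
Proof. unfold srcQ. ring. Qed.

Lemma srcS_sub E S mu z z' n : srcS E S mu (fun j m => z j m - z' j m) n
  = srcS E S mu z n - srcS E S mu z' n.
Proof. unfold srcS. ring. Qed.

(** On the zero modes themselves the pairings are exact multiples of the four constants; the rest is
    [pairing_error]. *)
Lemma residual_leading E S mu : psize E S mu <= smallness ->
  let C := pairC * psize E S mu ^ 2 in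
  Rabs (- residQ E S mu (sol 1 0 E S mu) - E * normA) <= C /\
  Rabs (- residQ E S mu (sol 0 1 E S mu) - S * crossQ) <= C /\
  Rabs (- residS E S mu (sol 1 0 E S mu) - S * crossS) <= C /\
  Rabs (- residS E S mu (sol 0 1 E S mu) - E * normP) <= C.
Proof.
  intros HP C.
  assert (HsM := Rlt_le _ _ solM_pos). assert (HPn := psize_nonneg E S mu).
  assert (Hd : forall t1 t2, is_unit_seed t1 t2 ->
    wbounded weight (solLip * psize E S mu)
      (fun j n => sol t1 t2 E S mu j n - sol t1 t2 0 0 0 j n)).
  { intros t1 t2 Ht. assert (H := sol_lipschitz t1 t2 E S mu 0 0 0 Ht HP psize_zero_small).
    rewrite !Rminus_0_r in H. exact H. }
  assert (U1 := unit_seed_10). assert (U2 := unit_seed_01).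
  assert (B1 := sol_bounded 1 0 E S mu U1 HP). assert (B2 := sol_bounded 0 1 E S mu U2 HP).
  rewrite (residQ_pairing E S mu 1 0 _ _ HsM B1 (sol_solution 1 0 E S mu U1 HP)).
  rewrite (residQ_pairing E S mu 0 1 _ _ HsM B2 (sol_solution 0 1 E S mu U2 HP)).
  rewrite (residS_pairing E S mu 1 0 _ _ HsM B1 (sol_solution 1 0 E S mu U1 HP)).
  rewrite (residS_pairing E S mu 0 1 _ _ HsM B2 (sol_solution 0 1 E S mu U2 HP)).
  rewrite !Ropp_involutive. unfold normA, crossQ, crossS, normP. rewrite <- !Zsum_scal.
  assert (EQ := fun g src x y => pairing_error g src (psize E S mu) x y HPn).
  assert (SQ : forall M z n, 0 <= M -> wbounded weight M z ->
     Rabs (srcQ E S mu z n) <= 2 * B ^ 2 * psize E S mu * (M * nearU * zp n)).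
  { intros. now apply src_bound. }
  assert (SS : forall M z n, 0 <= M -> wbounded weight M z ->
     Rabs (srcS E S mu z n) <= 2 * B ^ 2 * psize E S mu * (M * nearU * zp n)).
  { intros. now apply src_bound. }
  repeat split.
  - rewrite (Zsum_ext (fun n => E * (phi n * srcQ 1 0 0 mode1 n))
      (fun n => phi n * srcQ E S mu mode1 n))
      by (intros n; rewrite !(proj1 (mode1_src _ _ _ n)); ring).
    apply EQ; trivial; [exact phi_decays|apply srcQ_sub|exact mode1_bounded|now apply Hd].
  - rewrite (Zsum_ext (fun n => S * (phi n * srcQ 0 1 0 mode2 n))
      (fun n => phi n * srcQ E S mu mode2 n))
      by (intros n; rewrite !(proj1 (mode2_src _ _ _ n)); ring).
    apply EQ; trivial; [exact phi_decays|apply srcQ_sub|exact mode2_bounded|now apply Hd].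
  - rewrite (Zsum_ext (fun n => S * (psi n * srcS 0 1 0 mode1 n))
      (fun n => psi n * srcS E S mu mode1 n))
      by (intros n; rewrite !(proj2 (mode1_src _ _ _ n)); ring).
    apply EQ; trivial; [exact psi_decays|apply srcS_sub|exact mode1_bounded|now apply Hd].
  - rewrite (Zsum_ext (fun n => E * (psi n * srcS 1 0 0 mode2 n))
      (fun n => psi n * srcS E S mu mode2 n))
      by (intros n; rewrite !(proj2 (mode2_src _ _ _ n)); ring).
    apply EQ; trivial; [exact psi_decays|apply srcS_sub|exact mode2_bounded|now apply Hd].
Qed.

(** * Eigenfunctions from a singular residual matrix *)

Lemma sol_continuous t1 t2 E0 S mu j n : is_unit_seed t1 t2 ->
  psize E0 S mu < smallness -> continuity_pt (fun E => sol t1 t2 E S mu j n) E0.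
Proof.
  intros Ht HP eps0 Heps0.
  set (k := solLip * weight j n).
  assert (Hk : 0 <= k).
  { apply Rmult_le_pos; [exact solLip_nonneg|apply Rlt_le, weight_pos]. }
  exists (Rmin (smallness - psize E0 S mu) (eps0 / (k + 1))). split.
  - apply Rmin_glb_lt; [lra|]. apply Rdiv_lt_0_compat; lra.
  - intros E [_ HE]. unfold dist in *. simpl in *. unfold Rdist in *.
    assert (HE1 := Rlt_le_trans _ _ _ HE (Rmin_l _ _)).
    assert (HE2 := Rlt_le_trans _ _ _ HE (Rmin_r _ _)).
    assert (HPE : psize E S mu <= smallness).
    { assert (T := Rabs_triang (E - E0) E0). replace (E - E0 + E0) with E in T by ring. lra. }
    assert (H := sol_lipschitz t1 t2 E S mu E0 S mu Ht HPE (Rlt_le _ _ HP) j n).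
    cbv beta in H. rewrite !Rminus_diag, !Rabs_R0, !Rplus_0_r in H.
    eapply Rle_lt_trans; [exact H|].
    replace (solLip * Rabs (E - E0) * weight j n) with (k * Rabs (E - E0)) by (unfold k; ring).
    apply Rlt_div_r in HE2; [|lra]. assert (Hp := Rabs_pos (E - E0)). nra.
Qed.

Lemma residual_combine E S mu t1 t2 x y :
  residQ E S mu (fun j n => t1 * x j n + t2 * y j n)
    = t1 * residQ E S mu x + t2 * residQ E S mu y /\
  residS E S mu (fun j n => t1 * x j n + t2 * y j n)
    = t1 * residS E S mu x + t2 * residS E S mu y.
Proof. unfold residQ, residS, srcQ, srcS. split; ring. Qed.

Lemma singular_2x2_kernel a11 a12 a21 a22 : a11 * a22 - a12 * a21 = 0 ->
  exists t1 t2, (t1 <> 0 \/ t2 <> 0) /\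
    t1 * a11 + t2 * a12 = 0 /\ t1 * a21 + t2 * a22 = 0.
Proof.
  intros H. destruct (Req_dec a11 0) as [H1|H1]; [destruct (Req_dec a12 0) as [H2|H2]|].
  - destruct (Req_dec a21 0) as [H3|H3].
    + exists 1, 0. rewrite H1, H3. repeat split; [left; lra|ring|ring].
    + exists (- a22), a21. rewrite H1, H2. repeat split; [now right|ring|ring].
  - exists a12, (- a11). repeat split; [now left|ring|lra].
  - exists (- a12), a11. repeat split; [now right|ring|lra].
Qed.

Definition real_system (E C S : R) (x : state) : Prop := forall n,
  E * x cP n = b n * x cS n + b n * x cY n
               + cc n * (C * x cS (n + 1)%Z - S * x cA (n + 1)%Z) /\
  E * x cQ n = b n * x cA n - cc n * (C * x cA (n + 1)%Z + S * x cS (n + 1)%Z) /\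
  E * x cR n = 2 * b n * x cS n + d (n - 2)%Z * x cY (n - 2)%Z /\
  E * x cS n = b n * x cP n + b n * x cR n
               + cc (n - 1)%Z * (C * x cP (n - 1)%Z - S * x cQ (n - 1)%Z) /\
  E * x cA n = b n * x cQ n - cc (n - 1)%Z * (C * x cQ (n - 1)%Z + S * x cP (n - 1)%Z) /\
  E * x cY n = 2 * b n * x cP n + d n * x cR (n + 2)%Z.

Lemma solution_real_system E S mu t1 t2 x : seed_sweep_solution E S mu t1 t2 x ->
  residQ E S mu x = 0 -> residS E S mu x = 0 -> real_system E (1 - mu) S x.
Proof.
  intros Hx HQ0 HS0 n.
  assert (EA := solution_A E S mu t1 t2 x Hx). assert (EP := solution_P E S mu t1 t2 x Hx).
  assert (ER := solution_R E S mu t1 t2 x Hx). assert (EY := solution_Y E S mu t1 t2 x Hx).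
  assert (EQ : b n * x cQ n - cc (n - 1)%Z * x cQ (n - 1)%Z = srcQ E S mu x n).
  { destruct (Z.eq_dec n 0) as [->|Hn]; [|now apply (solution_Q E S mu t1 t2 x Hx)].
    simpl Z.sub. unfold residQ in HQ0. lra. }
  assert (ES : b n * x cS n + cc n * x cS (n + 1)%Z - mm n * x cS (n + 2)%Z = srcS E S mu x n).
  { destruct (Z.eq_dec n 0) as [->|Hn]; [|now apply (solution_S E S mu t1 t2 x Hx)].
    simpl Z.add. unfold residS in HS0. lra. }
  assert (Hd := coef_d_pos n). assert (Hd2 := coef_d_pos (n - 2)).
  assert (Y2 := EY (n - 2)%Z). replace (n - 2 + 2)%Z with n in Y2 by lia.
  assert (R2 := ER (n - 2)%Z). replace (n - 2 + 2)%Z with n in R2 by lia.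
  (* Multiplying the defining rows of [cY] and [cR] by quotients of [b] by [d] undoes their
     elimination from the recursions. *)
  assert (bY : b n * x cY n = - mm n * x cS (n + 2)%Z + E * (b n / d n) * x cR (n + 2)%Z).
  { transitivity (b n / d n * (d n * x cY n)); [field; lra|]. rewrite EY.
    unfold coef_m. field. lra. }
  assert (bR : b n * x cR n = - mm (n - 2) * x cP (n - 2)%Z
               + E * (b n / d (n - 2)%Z) * x cY (n - 2)%Z).
  { transitivity (b n / d (n - 2)%Z * (d (n - 2)%Z * x cR n)); [field; lra|]. rewrite R2.
    unfold coef_m. replace (n - 2 + 2)%Z with n by lia. field. lra. }
  specialize (EA n). specialize (EP n). specialize (ER n).
  unfold srcA in EA. unfold srcP in EP. unfold srcQ in EQ. unfold srcS in ES.
  repeat split; lra.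
Qed.

Ltac cont_pt := repeat match goal with
  | |- continuity_pt (fun E => @?f E + @?g E) _ => apply (continuity_pt_plus f g)
  | |- continuity_pt (fun E => @?f E - @?g E) _ => apply (continuity_pt_minus f g)
  | |- continuity_pt (fun E => @?f E * @?g E) _ => apply (continuity_pt_mult f g)
  | |- continuity_pt (fun E => - @?f E) _ => apply (continuity_pt_opp f)
  | |- continuity_pt (fun E => E) _ => apply continuity_pt_id
  | |- continuity_pt (fun E => sol _ _ E _ _ _ _) _ => apply sol_continuous
  | |- continuity_pt (fun _ => _) _ => apply continuity_pt_const; intros ? ?; reflexivity
  end.

Lemma residual_continuous t1 t2 E S mu : is_unit_seed t1 t2 -> psize E S mu < smallness ->
  continuity_pt (fun E => - residQ E S mu (sol t1 t2 E S mu)) E /\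
  continuity_pt (fun E => - residS E S mu (sol t1 t2 E S mu)) E.
Proof.
  intros Ht HP. unfold residQ, residS, srcQ, srcS. split; cont_pt; trivial.
Qed.

Lemma real_mode_in_gap : exists e1 s0 L : R, 0 < e1 /\ 0 < s0 /\ 0 < L /\
  forall S mu, 0 < Rabs S < s0 -> Rabs mu <= Rabs S ->
  exists (E M : R) (x : state), Rabs (E - e1 * Rabs S) <= L * S ^ 2 /\
    (forall j, decays rho M (x j)) /\ real_system E (1 - mu) S x /\
    (x cA 0%Z <> 0 \/ x cP 0%Z <> 0).
Proof.
  destruct leading_pos as [L1 [L2 [L3 L4]]]. assert (Hsm := smallness_pos).
  assert (HpC := pairC_nonneg).
  (* Since [|mu| <= |S|], the parameter size is at most [2 * (|E| + |S|)], whence the factor 4. Half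
     of [smallness] goes to [E] and a quarter each to [S] and [mu]. *)
  destruct (perturbed_det_root normA normP crossQ crossS (4 * pairC) (smallness / 2))
    as [e1 [s0 [L [He1 [Hs0 [HLp Hroot']]]]]]; trivial; try lra.
  exists e1, (Rmin s0 (smallness / 4)), L.
  split; [trivial|]. split; [apply Rmin_glb_lt; lra|]. split; [trivial|].
  intros S mu HS Hmu. destruct HS as [HS1 HS2].
  assert (HS3 := Rlt_le_trans _ _ _ HS2 (Rmin_l _ _)).
  assert (HS4 := Rlt_le_trans _ _ _ HS2 (Rmin_r _ _)).
  assert (HP : forall E, Rabs E < smallness / 2 -> psize E S mu < smallness) by (intros; lra).
  destruct (Hroot' S (fun E => - residQ E S mu (sol 1 0 E S mu))
    (fun E => - residQ E S mu (sol 0 1 E S mu))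
    (fun E => - residS E S mu (sol 1 0 E S mu))
    (fun E => - residS E S mu (sol 0 1 E S mu))) as [E [HE1 [HE2 HE3]]].
  - split; trivial.
  - intros E HE. destruct (residual_leading E S mu (Rlt_le _ _ (HP E HE))) as [G1 [G2 [G3 G4]]].
    assert (HC : pairC * psize E S mu ^ 2 <= 4 * pairC * (Rabs E + Rabs S) ^ 2).
    { replace (4 * pairC * (Rabs E + Rabs S) ^ 2) with
        (pairC * (2 * (Rabs E + Rabs S)) ^ 2) by ring.
      apply Rmult_le_compat_l; trivial. apply pow_incr.
      assert (H := psize_nonneg E S mu). assert (H' := Rabs_pos E). lra. }
    repeat split; eapply Rle_trans; eassumption.
  - intros E HE. specialize (HP E HE).
    destruct (residual_continuous 1 0 E S mu unit_seed_10 HP) as [C1 C2].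
    destruct (residual_continuous 0 1 E S mu unit_seed_01 HP) as [C3 C4].
    match goal with |- continuity_pt (fun E => @?f E * @?g E - @?f' E * @?g' E) _ =>
      apply (continuity_pt_minus (fun E => f E * g E) (fun E => f' E * g' E));
      [apply (continuity_pt_mult f g)|apply (continuity_pt_mult f' g')] end; trivial.
  - specialize (HP E HE1).
    assert (U1 := unit_seed_10). assert (U2 := unit_seed_01).
    destruct (singular_2x2_kernel _ _ _ _ HE3) as [t1 [t2 [Ht [K1 K2]]]].
    assert (S1 := sol_solution 1 0 E S mu U1 (Rlt_le _ _ HP)).
    assert (S2 := sol_solution 0 1 E S mu U2 (Rlt_le _ _ HP)).
    assert (B1 := sol_bounded 1 0 E S mu U1 (Rlt_le _ _ HP)).
    assert (B2 := sol_bounded 0 1 E S mu U2 (Rlt_le _ _ HP)).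
    set (x := fun j n => t1 * sol 1 0 E S mu j n + t2 * sol 0 1 E S mu j n).
    assert (Sx : seed_sweep_solution E S mu t1 t2 x) by now apply solution_combine.
    exists E, ((Rabs t1 + Rabs t2) * (solM * wgtU)), x.
    split; [trivial|]. split; [|split].
    + intros j n.
      assert (D1 := wbounded_decays _ _ j (Rlt_le _ _ solM_pos) B1 n).
      assert (D2 := wbounded_decays _ _ j (Rlt_le _ _ solM_pos) B2 n).
      unfold x. eapply Rle_trans; [apply Rabs_triang|]. rewrite !Rabs_mult.
      apply Rmult_le_compat_l with (r := Rabs t1) in D1; [|apply Rabs_pos].
      apply Rmult_le_compat_l with (r := Rabs t2) in D2; [|apply Rabs_pos].
      lra.
    + destruct (residual_combine E S mu t1 t2 (sol 1 0 E S mu) (sol 0 1 E S mu)) as [Q1 Q2].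
      apply solution_real_system with t1 t2; trivial; unfold x; lra.
    (* The entries at site 0 are the seed values, so a nonzero kernel vector gives a nonzero
       state. *)
    + destruct Ht as [Ht|Ht]; [left|right].
      * now rewrite (solution_A0 E S mu t1 t2 x Sx).
      * now rewrite (solution_P0 E S mu t1 t2 x Sx).
Qed.

End Weights.

End RealSystem.

(** * From the real system to the Bloch Hamiltonian *)

(** Here [z1] is given by the quadratic formula and [zt2] by the product [- m / bp] of the roots.
    From [bp < cp] one gets [m < bp + cp], so the polynomial is positive at 1 and [z1 < 1]; it also
    gives [bp * z1 < m], so [zt2 > -1]. *)
Lemma right_roots bp cp : 0 < bp < cp -> exists z1 zt2,
  0 < z1 < 1 /\ -1 < zt2 < 0 /\ bp * z1 * z1 + cp * z1 = 2 * bp * bp / cp /\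
  bp * z1 = - (2 * bp * bp / cp) * zt2.
Proof.
  intros [Hb Hc]. set (m := 2 * bp * bp / cp).
  assert (Hm : 0 < m) by (apply Rdiv_lt_0_compat; nra).
  assert (Hm' : m < bp + cp).
  { unfold m. apply Rlt_div_l; [lra|]. nra. }
  set (D := cp * cp + 4 * bp * m).
  assert (HD : cp * cp < D) by (unfold D; nra).
  assert (Hs := sqrt_sqrt D ltac:(nra)). assert (Hs0 := sqrt_pos D).
  set (s := sqrt D) in *.
  assert (Hsc : cp < s).
  { apply Rnot_le_lt. intros Hn. assert (s * s <= cp * cp) by (apply Rmult_le_compat; lra). lra. }
  exists ((s - cp) / (2 * bp)), (- bp * ((s - cp) / (2 * bp)) / m).
  set (z := (s - cp) / (2 * bp)).
  assert (Hz : 0 < z) by (apply Rdiv_lt_0_compat; lra).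
  assert (Hq : bp * z * z + cp * z = m).
  { transitivity ((s * s - cp * cp) / (4 * bp)); [unfold z; field; lra|].
    rewrite Hs. unfold D. field. lra. }
  assert (Hz1 : z < 1).
  { apply Rnot_le_lt. intros Hn. assert (1 <= z * z) by nra.
    assert (bp * 1 <= bp * (z * z)) by (apply Rmult_le_compat_l; lra).
    assert (cp * 1 <= cp * z) by (apply Rmult_le_compat_l; lra). lra. }
  repeat split; trivial.
  - apply Rlt_div_r; [trivial|]. nra.
  - apply Rlt_div_l; [trivial|]. nra.
  - field. lra.
Qed.

Lemma coef_bounds bp bm dp dm c : 0 < bp -> 0 < bm -> 0 < bp + dp -> 0 < bm + dm -> 0 < c ->
  exists B, 1 <= B /\ forall n,
    (coef_b bp bm n <= B /\ / coef_b bp bm n <= B) /\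
    (coef_c bp bm dp dm c n <= B /\ / coef_c bp bm dp dm c n <= B) /\
    (coef_d bp bm dp dm c n <= B /\ / coef_d bp bm dp dm c n <= B).
Proof.
  intros H1 H2 H3 H4 H5.
  assert (I1 := Rinv_0_lt_compat _ H1). assert (I2 := Rinv_0_lt_compat _ H2).
  assert (I3 := Rinv_0_lt_compat _ H3). assert (I4 := Rinv_0_lt_compat _ H4).
  assert (I5 := Rinv_0_lt_compat _ H5).
  exists (1 + bp + bm + (bp + dp) + (bm + dm) + c
          + / bp + / bm + / (bp + dp) + / (bm + dm) + / c).
  split; [lra|]. intros n. unfold coef_b, coef_c, coef_d.
  destruct (Z.leb 0 n), (Z.eqb n (-1)), (Z.leb (-2) n); repeat split; lra.
Qed.

Lemma interface_mode bp bm dp dm c : 0 < bp -> 0 < bm -> 0 < bm + dm -> 0 < dp -> dm < 0 ->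
  0 < c -> exists e1 s0 L rho : R, 0 < e1 /\ 0 < s0 /\ 0 < L /\ 0 < rho < 1 /\
  forall S mu, 0 < Rabs S < s0 -> Rabs mu <= Rabs S ->
  exists (E M : R) (x : state), Rabs (E - e1 * Rabs S) <= L * S ^ 2 /\
    (forall j, decays rho M (x j)) /\ real_system bp bm dp dm c E (1 - mu) S x /\
    (x cA 0%Z <> 0 \/ x cP 0%Z <> 0).
Proof.
  intros hbp hbm hcm hdp hdm hc. assert (hcp : 0 < bp + dp) by lra.
  destruct (right_roots bp (bp + dp)) as [z1 [zt2 [Hz1 [Hzt2 [Hq1 Hq2]]]]]; [lra|].
  destruct (coef_bounds bp bm dp dm c) as [B [HB HBn]]; trivial.
  assert (HA : 0 < bp / (bp + dp) < 1).
  { split; [now apply Rdiv_lt_0_compat|]. apply Rlt_div_l; lra. }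
  assert (HL : 0 < (bm + dm) / bm < 1).
  { split; [now apply Rdiv_lt_0_compat|]. apply Rlt_div_l; lra. }
  set (m0 := Rmax (Rmax (bp / (bp + dp)) ((bm + dm) / bm)) (Rmax z1 (- zt2))).
  assert (M1 : bp / (bp + dp) <= m0) by (eapply Rle_trans; [apply Rmax_l|apply Rmax_l]).
  assert (M2 : (bm + dm) / bm <= m0) by (eapply Rle_trans; [apply Rmax_r|apply Rmax_l]).
  assert (M3 : z1 <= m0) by (eapply Rle_trans; [apply Rmax_l|apply Rmax_r]).
  assert (M4 : - zt2 <= m0) by (eapply Rle_trans; [apply Rmax_r|apply Rmax_r]).
  assert (M5 : m0 < 1) by (unfold m0; repeat apply Rmax_lub_lt; lra).
  (* By Bernoulli's inequality [rho ^ 3] is at least [1 - (1 - m0) / 2], which is exactly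
     [m0 + eps]. *)
  set (rho := 1 - (1 - m0) / 6). set (eps := (1 - m0) / 2).
  assert (Hr3 : m0 + eps <= rho ^ 3).
  { unfold rho, eps. set (t := (1 - m0) / 6). replace m0 with (1 - 6 * t) by (unfold t; field).
    assert (Ht : 0 < t < 1) by (unfold t; lra).
    replace ((1 - t) ^ 3) with (1 - 3 * t + t * t * (3 - t)) by ring.
    assert (0 <= t * t * (3 - t)) by (apply Rmult_le_pos; nra). lra. }
  assert (Hrho : 0 < rho < 1) by (unfold rho; lra).
  assert (Heps : 0 < eps <= 1) by (unfold eps; lra).
  destruct (real_mode_in_gap bp bm dp dm c z1 zt2 hbp hbm hcp hcm hc Hz1 Hzt2 Hq1 Hq2
    rho eps B Hrho Heps) as [e1 [s0 [L [He1 [Hs0 [HLp Hm]]]]]];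
    try lra; try (intros n; apply HBn).
  exists e1, s0, L, rho. split; [trivial|]. split; [trivial|]. split; [trivial|].
  split; [trivial|]. exact Hm.
Qed.

(** * Gauge transformation and chiral partners *)

Lemma cexpi_add a b : cexpi (a + b) = Cmult (cexpi a) (cexpi b).
Proof.
  unfold cexpi, Cmult. simpl. rewrite cos_plus, sin_plus. f_equal. ring.
Qed.

Lemma Cmod_cexpi a : Cmod (cexpi a) = 1.
Proof.
  unfold Cmod, cexpi. simpl fst. simpl snd.
  replace (cos a ^ 2 + sin a ^ 2) with 1; [apply sqrt_1|].
  rewrite <- !Rsqr_pow2, Rplus_comm. symmetry. apply sin2_cos2.
Qed.

(* The gauge [exp(i th n)] spreads the Bloch phase evenly over the two [c] bonds, and
   the remaining factors of [i] make the system real. *)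
Definition gauged (sg th : R) (x : state) : vec := fun j n =>
  Cmult (cexpi (th * IZR n))
  match j with
  | 1%nat => (sg * x cP n, sg * x cQ n)
  | 2%nat => (sg * x cR n, 0)
  | 3%nat => (sg * x cP n, - (sg * x cQ n))
  | 4%nat => (x cS n, x cA n)
  | 5%nat => (x cY n, 0)
  | 6%nat => (x cS n, - x cA n)
  | _ => RtoC 0
  end.

Ltac real_parts :=
  unfold Cmult, Cplus, Copp, RtoC, cexpi; simpl; rewrite ?cos_neg, ?sin_neg;
  match goal with Hsg : _ \/ _ |- _ => destruct Hsg as [-> | ->] end; f_equal; lra.

Lemma gauged_eigen bp bm dp dm c E th sg x : sg = 1 \/ sg = -1 ->
  real_system bp bm dp dm c E (cos th) (sin th) x ->
  forall j n, valid_index j ->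
  H_II bp bm dp dm c (2 * th) (gauged sg th x) j n
  = Cmult (RtoC (- sg * E)) (gauged sg th x j n).
Proof.
  intros Hsg Hx j n Hj. destruct (Hx n) as [E1 [E2 [E3 [E4 [E5 E6]]]]].
  assert (Hj' : (j = 1 \/ j = 2 \/ j = 3 \/ j = 4 \/ j = 5 \/ j = 6)%nat)
    by (unfold valid_index in Hj; lia).
  unfold H_II, gauged.
  assert (G1 : Cmult (cexpi (- (2 * th))) (cexpi (th * IZR (n + 1)))
    = Cmult (cexpi (th * IZR n)) (cexpi (- th))).
  { rewrite <- !cexpi_add, plus_IZR. f_equal. ring. }
  assert (G2 : Cmult (cexpi (2 * th)) (cexpi (th * IZR (n - 1)))
    = Cmult (cexpi (th * IZR n)) (cexpi th)).
  { rewrite <- !cexpi_add, minus_IZR. f_equal. ring. }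
  assert (G3 : cexpi (th * IZR (n + 1)) = Cmult (cexpi (th * IZR n)) (cexpi th)).
  { rewrite <- !cexpi_add, plus_IZR. f_equal. ring. }
  assert (G4 : cexpi (th * IZR (n - 1)) = Cmult (cexpi (th * IZR n)) (cexpi (- th))).
  { rewrite <- !cexpi_add, minus_IZR. f_equal. ring. }
  (* A [d] bond spans two sites, over which the gauge collects exactly the Bloch phase [2 * th]; the
     two cancel. *)
  assert (G5 : Cmult (cexpi (2 * th)) (cexpi (th * IZR (n - 2))) = cexpi (th * IZR n)).
  { rewrite <- !cexpi_add, minus_IZR. f_equal. ring. }
  assert (G6 : Cmult (cexpi (- (2 * th))) (cexpi (th * IZR (n + 2))) = cexpi (th * IZR n)).
  { rewrite <- !cexpi_add, plus_IZR. f_equal. ring. }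
  set (e := cexpi (th * IZR n)) in *.
  (* With the gauge factor [e] taken out of a row, its real and imaginary parts are combinations of
     the equations of [real_system]. *)
  assert (factor : forall X Y r z : C, Y = Cmult e X -> Copp X = Cmult r z ->
    Copp Y = Cmult e (Cmult r z)).
  { intros X Y r z -> H. rewrite <- H. ring. }
  assert (A : forall u v w z : C, Cmult (Cmult u v) (Cmult w z) = Cmult u (Cmult (Cmult v w) z))
    by (intros; ring).
  destruct Hj' as [->|[->|[->|[->|[->| ->]]]]];
    rewrite ?A, ?G1, ?G2, ?G5, ?G6, ?G3, ?G4;
  match goal with |- Copp (Cplus (Cplus ?u ?v) ?w) = Cmult ?r (Cmult e ?z) =>
    replace (Cmult r (Cmult e z)) with (Cmult e (Cmult r z)) by ring end.
  - apply (factor (Cplus (Cplus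
      (Cmult (RtoC (coef_b bp bm n)) (x cS n, x cA n))
      (Cmult (RtoC (coef_b bp bm n)) (x cY n, 0)))
      (Cmult (RtoC (coef_c bp bm dp dm c n)) (Cmult (cexpi (- th)) (x cS (n + 1)%Z, - x cA (n + 1)%Z))))); [ring|].
    real_parts.
  - apply (factor (Cplus (Cplus
      (Cmult (RtoC (coef_b bp bm n)) (x cS n, x cA n))
      (Cmult (RtoC (coef_d bp bm dp dm c (n - 2))) (x cY (n - 2)%Z, 0)))
      (Cmult (RtoC (coef_b bp bm n)) (x cS n, - x cA n)))); [ring|].
    real_parts.
  - apply (factor (Cplus (Cplus
      (Cmult (RtoC (coef_c bp bm dp dm c n)) (Cmult (cexpi th) (x cS (n + 1)%Z, x cA (n + 1)%Z)))
      (Cmult (RtoC (coef_b bp bm n)) (x cY n, 0)))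
      (Cmult (RtoC (coef_b bp bm n)) (x cS n, - x cA n)))); [ring|].
    real_parts.
  - apply (factor (Cplus (Cplus
      (Cmult (RtoC (coef_b bp bm n)) (sg * x cP n, sg * x cQ n))
      (Cmult (RtoC (coef_b bp bm n)) (sg * x cR n, 0)))
      (Cmult (RtoC (coef_c bp bm dp dm c (n - 1))) (Cmult (cexpi (- th)) (sg * x cP (n - 1)%Z, - (sg * x cQ (n - 1)%Z)))))); [ring|].
    real_parts.
  - apply (factor (Cplus (Cplus
      (Cmult (RtoC (coef_b bp bm n)) (sg * x cP n, sg * x cQ n))
      (Cmult (RtoC (coef_d bp bm dp dm c n)) (sg * x cR (n + 2)%Z, 0)))
      (Cmult (RtoC (coef_b bp bm n)) (sg * x cP n, - (sg * x cQ n))))); [ring|].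
    real_parts.
  - apply (factor (Cplus (Cplus
      (Cmult (RtoC (coef_c bp bm dp dm c (n - 1))) (Cmult (cexpi th) (sg * x cP (n - 1)%Z, sg * x cQ (n - 1)%Z)))
      (Cmult (RtoC (coef_b bp bm n)) (sg * x cR n, 0)))
      (Cmult (RtoC (coef_b bp bm n)) (sg * x cP n, - (sg * x cQ n))))); [ring|].
    real_parts.
Qed.

Lemma gauged_in_l2 sg th rho M x : 0 < rho < 1 -> sg = 1 \/ sg = -1 ->
  (forall j, decays rho M (x j)) -> in_l2 (gauged sg th x).
Proof.
  intros Hrho Hsg Hx j _.
  assert (HM : forall i n, (x i n) ^ 2 <= M ^ 2 * zpow rho n).
  { intros i n. specialize (Hx i n). rewrite <- pow2_abs.
    assert (Hp := zpow_pos rho Hrho n). assert (Hp1 := zpow_le_1 rho Hrho n).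
    apply Rle_trans with ((M * zpow rho n) ^ 2).
    - apply pow_incr. split; [apply Rabs_pos|trivial].
    - rewrite Rpow_mult_distr. apply Rmult_le_compat_l; [apply pow2_ge_0|]. simpl. nra. }
  assert (HM0 : forall n, 0 <= M ^ 2 * zpow rho n).
  { intros n. apply Rmult_le_pos; [apply pow2_ge_0|apply Rlt_le, zpow_pos; trivial]. }
  assert (HC : forall a b : R, Cmod (a, b) ^ 2 = a ^ 2 + b ^ 2).
  { intros a b. unfold Cmod. simpl fst. simpl snd. rewrite <- Rsqr_pow2. apply Rsqr_sqrt.
    apply Rplus_le_le_0_compat; apply pow2_ge_0. }
  assert (Hsg2 : forall a, (sg * a) ^ 2 = a ^ 2 /\ (- (sg * a)) ^ 2 = a ^ 2).
  { intros a. destruct Hsg as [-> | ->]; split; ring. }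
  assert (Hdec : decays rho (2 * M ^ 2) (fun n => Cmod (gauged sg th x j n) ^ 2)).
  { intros n. rewrite Rabs_pos_eq by apply pow2_ge_0.
    unfold gauged. rewrite Cmod_mult, Cmod_cexpi, Rmult_1_l.
    assert (Hb := HM). specialize (HM0 n).
    destruct j as [|[|[|[|[|[|[|j]]]]]]]; unfold RtoC; rewrite HC.
    all: try (rewrite ?(proj1 (Hsg2 _)), ?(proj2 (Hsg2 _))).
    all: assert (B1 := HM cP n); assert (B2 := HM cQ n); assert (B3 := HM cR n);
         assert (B4 := HM cS n); assert (B5 := HM cA n); assert (B6 := HM cY n);
         simpl in *; lra. }
  destruct (decays_ex_series rho Hrho _ _ Hdec) as [D1 D2].
  split; apply ex_series_Rabs; assumption.
Qed.

Lemma gauged_nonzero sg th x : sg = 1 \/ sg = -1 -> x cA 0%Z <> 0 \/ x cP 0%Z <> 0 ->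
  nonzero_vec (gauged sg th x).
Proof.
  intros Hsg Hx.
  assert (He : cexpi (th * IZR 0) <> RtoC 0).
  { apply Cmod_gt_0. rewrite Cmod_cexpi. lra. }
  destruct Hx as [Hx|Hx].
  - exists 4%nat, 0%Z. split; [unfold valid_index; lia|].
    apply Cmult_neq_0; [trivial|]. intros H. injection H. intros H1 _. now apply Hx.
  - exists 1%nat, 0%Z. split; [unfold valid_index; lia|].
    apply Cmult_neq_0; [trivial|]. intros H. injection H. intros _ H1.
    destruct Hsg as [-> | ->]; lra.
Qed.

Lemma real_system_eigenvalues bp bm dp dm c E th rho M x : 0 < rho < 1 ->
  (forall j, decays rho M (x j)) -> x cA 0%Z <> 0 \/ x cP 0%Z <> 0 ->
  real_system bp bm dp dm c E (cos th) (sin th) x ->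
  is_eigenvalue_II bp bm dp dm c (2 * th) E /\ is_eigenvalue_II bp bm dp dm c (2 * th) (- E).
Proof.
  intros Hrho Hd Hn Hx. split.
  (* By [gauged_eigen] the eigenvalue is [- sg * E], so the sign -1 belongs to [E]. *)
  - exists (gauged (-1) th x). split; [|split].
    + apply gauged_in_l2 with rho M; trivial. now right.
    + apply gauged_nonzero; trivial. now right.
    + intros j n Hj. rewrite (gauged_eigen _ _ _ _ _ E) by (trivial; now right).
      do 2 f_equal. ring.
  - exists (gauged 1 th x). split; [|split].
    + apply gauged_in_l2 with rho M; trivial. now left.
    + apply gauged_nonzero; trivial. now left.
    + intros j n Hj. rewrite (gauged_eigen _ _ _ _ _ E) by (trivial; now left).
      do 2 f_equal. ring.
Qed.

(** * Exchange of the two half-planes *)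

Definition reflected (w : vec) : vec := fun j n =>
  w (match j with 1 => 6 | 2 => 5 | 3 => 4 | 4 => 3 | 5 => 2 | 6 => 1 | _ => j end)%nat
    (- n - 1)%Z.

(** Bonds weighted by [c] and [d] at [n] join [n] to [n + 1] and to [n + 2]. Reflection turns the
    right end into the left one, which labels the bond and shifts the index by one or two more than
    for [b]. *)
Lemma coef_reflect bp bm dp dm c n :
  coef_b bm bp (- n - 1) = coef_b bp bm n /\
  coef_c bm bp dm dp c (- n - 2) = coef_c bp bm dp dm c n /\
  coef_d bm bp dm dp c (- n - 3) = coef_d bp bm dp dm c n.
Proof.
  unfold coef_b, coef_c, coef_d.
  repeat match goal with
  | |- context [Z.leb ?a ?b] => destruct (Z.leb_spec a b)
  | |- context [Z.eqb ?a ?b] => destruct (Z.eqb_spec a b)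
  end; try lia; repeat split; reflexivity.
Qed.

(** The reflection exchanges the components [j] and [7 - j] and turns hops to the right into hops to
    the left, which inverts the Bloch phase; hence [- k]. *)
Lemma is_eigenvalue_reflect bp bm dp dm c k E :
  is_eigenvalue_II bm bp dm dp c (- k) E -> is_eigenvalue_II bp bm dp dm c k E.
Proof.
  intros [w [Hl2 [Hnz Hw]]]. exists (reflected w). split; [|split].
  - intros j Hj.
    set (j' := (match j with 1 => 6 | 2 => 5 | 3 => 4 | 4 => 3 | 5 => 2 | 6 => 1 | _ => j end)%nat).
    assert (Hj' : valid_index j').
    { unfold valid_index in *. unfold j'. destruct j as [|[|[|[|[|[|[|j]]]]]]]; lia. }
    destruct (Hl2 j' Hj') as [S1 S2]. unfold reflected. fold j'. split.
    + exact S2.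
    + apply ex_series_ext with (2 := S1). intros m.
      replace (- (- Z.of_nat m - 1) - 1)%Z with (Z.of_nat m) by lia. reflexivity.
  - destruct Hnz as [j [n [Hj Hn]]].
    exists (match j with 1 => 6 | 2 => 5 | 3 => 4 | 4 => 3 | 5 => 2 | 6 => 1 | _ => j end)%nat,
      (- n - 1)%Z.
    unfold valid_index in *.
    unfold reflected. replace (- (- n - 1) - 1)%Z with n by lia.
    destruct j as [|[|[|[|[|[|[|j]]]]]]]; try lia; (split; [lia|exact Hn]).
  - intros j n Hj.
    destruct (coef_reflect bp bm dp dm c n) as [B0 [C0 D0]].
    destruct (coef_reflect bp bm dp dm c (n - 1)) as [_ [C1 _]].
    destruct (coef_reflect bp bm dp dm c (n - 2)) as [_ [_ D2]].
    assert (Hj' : (j = 1 \/ j = 2 \/ j = 3 \/ j = 4 \/ j = 5 \/ j = 6)%nat)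
      by (unfold valid_index in Hj; lia).
    assert (Hv : forall i, (1 <= i <= 6)%nat -> H_II bm bp dm dp c (- k) w i (- n - 1)%Z
      = Cmult (RtoC E) (w i (- n - 1)%Z)) by (intros; now apply Hw).
    unfold H_II in Hv.
    replace (- n - 1 - 1)%Z with (- n - 2)%Z in Hv by lia.
    replace (- n - 1 + 1)%Z with (- (n - 1) - 1)%Z in Hv by lia.
    replace (- n - 1 - 2)%Z with (- n - 3)%Z in Hv by lia.
    replace (- n - 1 + 2)%Z with (- (n - 2) - 1)%Z in Hv by lia.
    rewrite Ropp_involutive in Hv.
    unfold H_II, reflected.
    rewrite <- B0, <- C0, <- D0, <- C1, <- D2.
    replace (- (n + 1) - 1)%Z with (- n - 2)%Z by lia.
    replace (- (n + 2) - 1)%Z with (- n - 3)%Z by lia.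
    replace (- (n - 1) - 2)%Z with (- n - 1)%Z by lia.
    replace (- (n - 2) - 3)%Z with (- n - 1)%Z by lia.
    destruct Hj' as [->|[->|[->|[->|[->| ->]]]]].
    + rewrite <- (Hv 6%nat) by lia. ring.
    + rewrite <- (Hv 5%nat) by lia. ring.
    + rewrite <- (Hv 4%nat) by lia. ring.
    + rewrite <- (Hv 3%nat) by lia. ring.
    + rewrite <- (Hv 2%nat) by lia. ring.
    + rewrite <- (Hv 1%nat) by lia. ring.
Qed.

(** * From the coupling [sin (k / 2)] back to [k] *)

Lemma abs_sin_bounds th : Rabs th <= PI / 2 -> th <> 0 ->
  0 < Rabs (sin th) <= Rabs th /\ Rabs th - Rabs (sin th) <= th ^ 2 /\
  0 <= 1 - cos th <= Rabs (sin th).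
Proof.
  assert (Hpos : forall t, 0 < t <= PI / 2 ->
    0 < sin t <= t /\ t - sin t <= t ^ 2 /\ 0 <= 1 - cos t <= sin t).
  { intros t Ht. assert (HPI := PI_RGT_0). assert (HPI4 := PI_4).
    assert (Hs : 0 < sin t) by (apply sin_gt_0; lra).
    assert (Hc : 0 <= cos t) by (apply cos_ge_0; lra).
    assert (Hc1 := COS_bound t). assert (Hs1 := SIN_bound t).
    assert (Hsc := sin2_cos2 t). unfold Rsqr in Hsc.
    assert (Hlt : sin t < t) by (apply sin_lt_x; lra).
    (* The order-zero Taylor bound is [t - t ^ 3 / 6 <= sin t]. *)
    destruct (pre_sin_bound t 0) as [Hlow _]; [lra|lra|].
    unfold sin_approx, sin_term in Hlow. simpl in Hlow.
    repeat split; try lra; [|nra].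
    assert (t * t * t / 6 <= t * t) by nra. simpl. lra. }
  intros Hth Hn0. destruct (Rle_or_lt 0 th) as [H|H].
  - rewrite (Rabs_pos_eq th) in * by lra. destruct (Hpos th) as [H1 [H2 H3]]; [lra|].
    rewrite Rabs_pos_eq by lra. repeat split; lra.
  - rewrite (Rabs_left th) in * by lra. destruct (Hpos (- th)) as [H1 [H2 H3]]; [lra|].
    rewrite sin_neg in *. rewrite cos_neg in *. rewrite Rabs_left by lra.
    replace (th ^ 2) with ((- th) ^ 2) by ring. repeat split; lra.
Qed.

Lemma positive_interface_eigenvalues bp bm dp dm c :
  0 < bp -> 0 < bm -> 0 < bm + dm -> 0 < dp -> dm < 0 -> 0 < c ->
  exists E1 : R, 0 < E1 /\ exists k0 : R, 0 < k0 /\ exists K : R,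
    forall k : R, Rabs k <= PI -> 0 < Rabs k < k0 ->
      exists E : R, 0 < E /\ is_eigenvalue_II bp bm dp dm c k E /\
        is_eigenvalue_II bp bm dp dm c k (- E) /\
        Rabs (E - E1 * Rabs k) <= K * k ^ 2.
Proof.
  intros hbp hbm hcm hdp hdm hc.
  destruct (interface_mode bp bm dp dm c) as [e1 [s0 [L [rho [He1 [Hs0 [HL [Hrho Hm]]]]]]]];
    trivial.
  assert (HeL : 0 < e1 / L) by (apply Rdiv_lt_0_compat; trivial).
  (* The factor one half is the slope of [sin (k / 2)] at 0. The bound [e1 / L] keeps the correction
     [L * sin th ^ 2] below [e1 * |sin th|], so [E] is positive and differs from [- E]. *)
  exists (e1 / 2). split; [lra|]. exists (Rmin s0 (e1 / L)). split; [now apply Rmin_glb_lt|].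
  (* Here [L] comes from the root estimate and [e1] from replacing [|sin th|] by [|th|]. *)
  exists (L + e1). intros k Hk Hk0.
  assert (HkA := Rlt_le_trans _ _ _ (proj2 Hk0) (Rmin_l _ _)).
  assert (HkB := Rlt_le_trans _ _ _ (proj2 Hk0) (Rmin_r _ _)).
  set (th := k / 2). assert (Hkt : k = 2 * th) by (unfold th; field).
  assert (Hab : Rabs k = 2 * Rabs th) by (rewrite Hkt, Rabs_mult, Rabs_pos_eq; lra).
  assert (Hth0 : th <> 0).
  { intros H. rewrite H, Rabs_R0 in Hab. lra. }
  destruct (abs_sin_bounds th) as [Hs1 [Hs2 Hs3]]; [lra|trivial|].
  destruct (Hm (sin th) (1 - cos th)) as [E [M [x [HE [Hd [Hx Hnz]]]]]].
  { lra. }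
  { rewrite Rabs_pos_eq; lra. }
  replace (1 - (1 - cos th)) with (cos th) in Hx by ring.
  assert (Hss : sin th ^ 2 = Rabs (sin th) ^ 2) by (now rewrite pow2_abs).
  assert (Htt : th ^ 2 = Rabs th ^ 2) by (now rewrite pow2_abs).
  assert (Hst : sin th ^ 2 <= th ^ 2) by (rewrite Hss, Htt; apply pow_incr; lra).
  exists E. split; [|rewrite Hkt; split; [|split]].
  - apply Rabs_le_between in HE. rewrite Hss in HE.
    assert (HLs : L * Rabs (sin th) < e1).
    { apply Rlt_div_r in HkB; [|trivial]. nra. }
    assert (L * Rabs (sin th) ^ 2 < e1 * Rabs (sin th)) by (simpl; nra). lra.
  - now apply (real_system_eigenvalues bp bm dp dm c E th rho M x).
  - now apply (real_system_eigenvalues bp bm dp dm c E th rho M x).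
  - rewrite <- Hkt, Hab.
    replace (E - e1 / 2 * (2 * Rabs th)) with
      ((E - e1 * Rabs (sin th)) + - (e1 * (Rabs th - Rabs (sin th)))) by field.
    eapply Rle_trans; [apply Rabs_triang|]. rewrite Rabs_Ropp, (Rabs_pos_eq (e1 * _)) by nra.
    assert (H1 : L * sin th ^ 2 <= L * th ^ 2) by (apply Rmult_le_compat_l; lra).
    assert (H2 : e1 * (Rabs th - Rabs (sin th)) <= e1 * th ^ 2)
      by (apply Rmult_le_compat_l; lra).
    assert (H3 : 0 <= (L + e1) * th ^ 2) by (apply Rmult_le_pos; [lra|apply pow2_ge_0]).
    rewrite Hkt. replace ((L + e1) * (2 * th) ^ 2) with (4 * ((L + e1) * th ^ 2)) by ring.
    lra.
Qed.

Theorem theorem15 (bp bm dp dm c : R)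
  (hbp : 0 < bp) (hbm : 0 < bm)
  (hdp : 0 < bp + dp) (hdm : 0 < bm + dm)
  (hdd : dp * dm < 0) (hc : 0 < c) :
  exists E1 : R, E1 <> 0 /\
  exists k0 : R, 0 < k0 /\
  exists K : R,
    forall k : R, - PI <= k < PI -> 0 < Rabs k < k0 ->
      exists Ep Em : R,
        Ep <> Em /\
        is_eigenvalue_II bp bm dp dm c k Ep /\
        is_eigenvalue_II bp bm dp dm c k Em /\
        Rabs (Ep - E1 * Rabs k) <= K * k ^ 2 /\
        Rabs (Em - (- E1 * Rabs k)) <= K * k ^ 2.
Proof.
  assert (Hmain : exists E1 : R, 0 < E1 /\ exists k0 : R, 0 < k0 /\ exists K : R,
    forall k : R, Rabs k <= PI -> 0 < Rabs k < k0 ->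
      exists E : R, 0 < E /\ is_eigenvalue_II bp bm dp dm c k E /\
        is_eigenvalue_II bp bm dp dm c k (- E) /\
        Rabs (E - E1 * Rabs k) <= K * k ^ 2).
  { destruct (Rlt_or_le 0 dp) as [Hp|Hp].
    - apply positive_interface_eigenvalues; trivial. nra.
    (* Now [dp < 0 < dm], so the interface with its sides exchanged is the case already treated; the
       estimate is even in [k], so it can be read at [- k]. *)
    - destruct (positive_interface_eigenvalues bm bp dm dp c)
        as [E1 [HE1 [k0 [Hk0 [K HK]]]]]; trivial; try nra.
      exists E1. split; [trivial|]. exists k0. split; [trivial|]. exists K.
      intros k Hk Hkk. destruct (HK (- k)) as [E HE]; try (rewrite Rabs_Ropp; trivial).
      exists E. rewrite Rabs_Ropp in HE. replace ((- k) ^ 2) with (k ^ 2) in HE by ring.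
      destruct HE as [G1 [G2 [G3 G4]]].
      repeat split; trivial; now apply is_eigenvalue_reflect. }
  destruct Hmain as [E1 [HE1 [k0 [Hk0 [K HK]]]]].
  exists E1. split; [lra|]. exists k0. split; [trivial|]. exists K.
  intros k Hk Hkk. destruct (HK k) as [E [G1 [G2 [G3 G4]]]]; trivial.
  { apply Rabs_le. lra. }
  exists E, (- E). split; [lra|]. repeat split; trivial.
  replace (- E - - E1 * Rabs k) with (- (E - E1 * Rabs k)) by ring. now rewrite Rabs_Ropp.
Qed.
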